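(* Let $0\le k<1$ and $0\le p<1$. Let $f$ be a harmonic mapping in $\mathbb{D}$ (with a pole at $p$) of the form $$f(z)=\frac{1}{z-p}+h(z)+\overline{g(z)}+A\log\left|\frac{1-pz}{z-p}\right|,\quad z\in\mathbb{D}\setminus\{p\},$$ where $A\in\mathbb{C}$ and $h(z)=\sum_{n=1}^{\infty}a_nz^n$, $g(z)=\sum_{n=1}^{\infty}b_nz^n$ are analytic in $\mathbb{D}$, and suppose that $$|h'(z)|+|g'(z)|\le\frac{k}{(1+p)^2}-\frac{p^2+1}{1-p^2}|A|,\quad z\in\mathbb{D}.$$ Then $f\in\Sigma_H^k(p)$. The quasiconformal extension of $f$ is given by $$F(z)=\begin{cases} f(z), & z\in\mathbb{D},\\[2pt] \dfrac{1}{z-p}+h\left(\dfrac{1}{\overline z}\right)+\overline{g\left(\dfrac{1}{\overline z}\right)}, & z\in\overline{\mathbb{D}^*}.\end{cases}$$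
   Context: $\mathbb{D}=\{z\in\mathbb{C}:|z|<1\}$, $\widehat{\mathbb{C}}=\mathbb{C}\cup\{\infty\}$, $\mathbb{D}^*=\{z\in\widehat{\mathbb{C}}:|z|>1\}$, and $\overline{\mathbb{D}^*}$ is its closure. A complex-valued function is harmonic if its real and imaginary parts are harmonic. For $p\in[0,1)$, $\Sigma_H'(p)$ is the class of all sense-preserving univalent (injective) harmonic mappings $f$ in $\mathbb{D}$ (with values in $\widehat{\mathbb{C}}$) that have a simple pole at $p$ (so $f(p)=\infty$) and are normalized as $$f(z)=\frac{1}{z-p}+h(z)+\overline{g(z)}+A\log\left|\frac{1-pz}{z-p}\right|,\quad z\in\mathbb{D}\setminus\{p\},$$ where $A\in\mathbb{C}$ and $h(z)=\sum_{n\ge1}a_nz^n$, $g(z)=\sum_{n\ge1}b_nz^n$ are analytic in $\mathbb{D}$. For $k\in[0,1)$ and a domain $\Omega\subset\widehat{\mathbb{C}}$, a sense-preserving homeomorphism $F$ of $\Omega$ onto its image in $\widehat{\mathbb{C}}$ is $k$-quasiconformal if it has locally $L^2$ derivatives (in the sense of distributions) on $\Omega\setminus\{F^{-1}(\infty),\infty\}$ and satisfies $|F_{\bar z}|\le k|F_z|$ almost everywhere. A univalent harmonic function $f$ on $\Omega$ admits a $k$-quasiconformal extension to $\widehat{\mathbb{C}}$ if there is a $k$-quasiconformal mapping $F:\widehat{\mathbb{C}}\to\widehat{\mathbb{C}}$ with $F|_\Omega=f$. $\Sigma_H^k(p)$ is the set of $f\in\Sigma_H'(p)$ that admit a $k$-quasiconformal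 extension to $\widehat{\mathbb{C}}$. In the formula for $F$, $1/\overline z$ and $1/(z-p)$ are taken to be $0$ at $z=\infty$, and on $|z|=1$ the values of $h$ and $g$ are those of their continuous extensions to $\overline{\mathbb{D}}$. *)

(* Defs.v *)
From HB Require Import structures.
From mathcomp Require Import all_boot all_order all_algebra.
From mathcomp Require Import all_classical all_reals all_analysis.
From mathcomp Require Import complex.

Set Implicit Arguments.
Unset Strict Implicit.
Unset Printing Implicit Defensive.
Import Order.TTheory GRing.Theory Num.Theory numFieldNormedType.Exports.
Local Open Scope classical_set_scope.
Local Open Scope complex_scope.
Local Open Scope ring_scope.

(* R[i], typed as a numClosedFieldType so that it inherits the norm topology
   that MathComp-Analysis puts on every numFieldType. Norms of complex numbers
   are themselves elements of [cplx R], and for u v : cplx R the order u <= v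
   means Im u = Im v and Re u <= Re v. *)
Definition cplx (R : realType) : numClosedFieldType := R[i].

Definition sphere (R : realType) : topologicalType :=
  one_point_compactification (cplx R).

Definition fin (R : realType) (w : cplx R) : sphere R := Some w.

Definition infty (R : realType) : sphere R := None.
Arguments infty {R}.

(* The value at infinity is junk. *)
Definition affine (R : realType) (w : sphere R) : cplx R :=
  if w is Some z then z else 0.

Definition pt (R : realType) (x : R * R) : cplx R := x.1 +i* x.2.

Definition disk (R : realType) : set (cplx R) := [set z | `|z| < 1].

Definition closed_disk (R : realType) : set (cplx R) := [set z | `|z| <= 1].

Definition cis (R : realType) (t : R) : cplx R := cos t +i* sin t.

(** * Partial derivatives, harmonic functions and test functions *)

Definition axis (R : realType) (b : bool) : R * R :=
  if b then (0, 1) else (1, 0).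

Definition partial (R : realType) (b : bool) (u : R * R -> R) : R * R -> R :=
  'D_(axis R b) u.

Definition partials (R : realType) (s : seq bool) (u : R * R -> R) :
    R * R -> R :=
  foldr (@partial R) u s.

Definition classC (R : realType) (n : nat) (U : set (R * R)) (u : R * R -> R) :=
  forall s : seq bool, (size s <= n)%N -> forall x, U x ->
    {for x, continuous (partials s u)} /\
    ((size s < n)%N -> forall b, derivable (partials s u) x (axis R b)).

Definition harmonic (R : realType) (U : set (R * R)) (u : R * R -> R) :=
  classC 2 U u /\
  forall x, U x ->
    partial false (partial false u) x + partial true (partial true u) x = 0.

Definition charmonic (R : realType) (U : set (cplx R))
    (f : cplx R -> cplx R) :=
  harmonic (@pt R @^-1` U) (fun x => complex.Re (f (pt x))) /\
  harmonic (@pt R @^-1` U) (fun x => complex.Im (f (pt x))).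

Definition test_function (R : realType) (U : set (R * R)) (phi : R * R -> R) :=
  let supp := closure [set x | phi x != 0] in
  [/\ forall n, classC n setT phi, compact supp & supp `<=` U].

(** * Sense-preserving maps *)

Definition winding_number (R : realType) (gamma : R -> cplx R) (w : cplx R)
    (n : int) :=
  exists theta : R -> R,
    [/\ {within `[0, 1], continuous theta},
        forall t, t \in `[0, 1] ->
          gamma t != w /\ gamma t - w = `|gamma t - w| * cis (theta t)
      & theta 1 - theta 0 = n%:~R * (2 * pi)].

(* Meant for an injective continuous f on an open set U: small circles around
   each finite point with finite image are mapped to loops of winding number 1
   around the image point. The orientation of a homeomorphism is locally
   constant, so the points with infinite image need no separate test. *)
Definition sense_preserving (R : realType) (U : set (cplx R))
    (f : cplx R -> sphere R) :=
  forall z w, U z -> f z = fin w ->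
    \forall r \near (0 : R)^'+,
      exists gamma : R -> cplx R,
        (forall t, t \in `[0, 1] ->
           f (z + r%:C * cis (2 * pi * t)) = fin (gamma t)) /\
        winding_number gamma w 1.

(** * Quasiconformal mappings *)

Definition homeo_onto_image (R : realType) (W : set (sphere R))
    (F : sphere R -> sphere R) :=
  {within W, continuous F} /\
  exists G : sphere R -> sphere R,
    {within F @` W, continuous G} /\ forall z, W z -> G (F z) = z.

Definition lebesgue2 (R : realType) :=
  (@lebesgue_measure R \x @lebesgue_measure R)%E.

Definition weak_partial (R : realType) (b : bool) (U : set (R * R))
    (u w : R * R -> R) :=
  forall phi, test_function U phi ->
    (\int[@lebesgue2 R]_(x in U) (u x * partial b phi x)%:E =
     - \int[@lebesgue2 R]_(x in U) (w x * phi x)%:E)%E.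

Definition locally_L2 (R : realType) (U : set (R * R)) (w : R * R -> R) :=
  measurable_fun U w /\
  forall K, compact K -> K `<=` U ->
    (\int[@lebesgue2 R]_(x in K) ((w x ^+ 2)%:E) < +oo)%E.

Definition weak_partial_L2 (R : realType) (b : bool) (U : set (R * R))
    (f w : R * R -> cplx R) :=
  [/\ weak_partial b U (@complex.Re R \o f) (@complex.Re R \o w),
      weak_partial b U (@complex.Im R \o f) (@complex.Im R \o w),
      locally_L2 U (@complex.Re R \o w)
    & locally_L2 U (@complex.Im R \o w)].

(* W is an open connected subset of the sphere. U is W without infinity and
   the preimage of infinity, and Fx, Fy are the weak derivatives there;
   F_z = (Fx - i Fy) / 2 and F_zbar = (Fx + i Fy) / 2. *)
Definition quasiconformal (R : realType) (k : R) (W : set (sphere R))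
    (F : sphere R -> sphere R) :=
  let U := [set x : R * R | W (fin (pt x)) /\ F (fin (pt x)) <> infty] in
  [/\ homeo_onto_image W F,
      sense_preserving [set z | W (fin z)] (F \o @fin R)
    & exists Fx Fy : R * R -> cplx R,
        [/\ weak_partial_L2 false U (fun x => affine (F (fin (pt x)))) Fx,
            weak_partial_L2 true U (fun x => affine (F (fin (pt x)))) Fy
          & {ae @lebesgue2 R, forall x, U x ->
              `|(Fx x + 'i%C * Fy x) / 2| <=
              k%:C * `|(Fx x - 'i%C * Fy x) / 2|}]].

Definition extends (R : realType) (U : set (cplx R)) (f : cplx R -> sphere R)
    (F : sphere R -> sphere R) :=
  forall z, U z -> F (fin z) = f z.

(** * The classes of harmonic mappings *)

(* [a 0] is irrelevant: the sum starts at n = 1. *)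
Definition power_series_on_disk (R : realType) (a : nat -> cplx R)
    (h : cplx R -> cplx R) :=
  forall z, disk z -> [series a n.+1 * z ^+ n.+1]_n @ \oo --> h z.

Definition pole_form (R : realType) (p : R) (A : cplx R)
    (h g : cplx R -> cplx R) (z : cplx R) : cplx R :=
  1 / (z - p%:C) + h z + conjc (g z) +
  A * (ln (Normc.normc ((1 - p%:C * z) / (z - p%:C))))%:C.

Definition has_form (R : realType) (p : R) (A : cplx R) (a b : nat -> cplx R)
    (h g : cplx R -> cplx R) (f : cplx R -> sphere R) :=
  [/\ power_series_on_disk a h, power_series_on_disk b g, f p%:C = infty
    & forall z, disk z -> z != p%:C -> f z = fin (pole_form p A h g z)].

Definition SigmaH' (R : realType) (p : R) (f : cplx R -> sphere R) :=
  [/\ charmonic (@disk R `\ (p%:C : cplx R)) (@affine R \o f),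
      sense_preserving (@disk R) f,
      set_inj (@disk R) f
    & exists A a b h g, has_form p A a b h g f].

Definition SigmaHk (R : realType) (k p : R) (f : cplx R -> sphere R) :=
  SigmaH' p f /\
  exists F, quasiconformal k [set: sphere R] F /\ extends (@disk R) f F.

(** * The explicit extension *)

Definition continuous_extension (R : realType) (h hbar : cplx R -> cplx R) :=
  {within @closed_disk R, continuous hbar} /\
  forall z, disk z -> hbar z = h z.

Definition F_ext (R : realType) (p : R) (f : cplx R -> sphere R)
    (hbar gbar : cplx R -> cplx R) (z : sphere R) : sphere R :=
  match z with
  | None => fin (0 + hbar 0 + conjc (gbar 0))
  | Some z =>
      if `|z| < 1 then f z
      else fin (1 / (z - p%:C) + hbar (1 / conjc z) + conjc (gbar (1 / conjc z)))
  end.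

(* Main.v *)
Require Import Defs.
From HB Require Import structures.
From mathcomp Require Import all_boot all_order all_algebra.
From mathcomp Require Import all_classical all_reals all_analysis.
From mathcomp Require Import measurable_realfun complex ring lra.

Set Implicit Arguments.
Unset Strict Implicit.
Unset Printing Implicit Defensive.
Import Order.TTheory GRing.Theory Num.Theory numFieldNormedType.Exports.
Local Open Scope classical_set_scope.
Local Open Scope complex_scope.
Local Open Scope ring_scope.

(* In the variable w = 1/(z - p) the extension is w + psi(w). In terms of
   o = (1 - p z)/(z - p) = (1 - p^2) w - p, the exterior of the disk is |o| <= 1 and
   psi = (h + conj g)(zeta(o)) + A log max(1, |o|), where zeta is 1 / conj z
   outside the disk and z inside. Since h + conj g is Lipschitz on the disk, the
   hypothesis makes psi Lipschitz with constant k on both sides of |o| = 1, and a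
   segment joining the two sides crosses that circle, so psi is k-Lipschitz on C.
   Hence w + psi(w) is injective, its increments are those of w up to a factor q
   with |q - 1| <= k, which gives the orientation, and off the circle
   |psi_w| + |psi_wbar| <= k, which gives the bound on the dilatation. *)

(** The coordinate w sends the pole to infinity and the point z = infinity to w = 0, so the singular
    part of f becomes the identity and the logarithm becomes A log max(1, |o|), which is harmless
    because log is 1-Lipschitz on [1, oo). The shape of the hypothesis comes from counting
    constants. On either closed side of |o| = 1 the map zeta has Lipschitz constant at most (1 -
    p^2)/(1 - p)^2 = (1 + p)/(1 - p), and o has slope 1 - p^2 in w. With L the right-hand side of
    the hypothesis, psi has constant at most (1 + p)^2 L + (1 - p^2)|A|, which equals k - 2p(1 +
    p)|A|/(1 - p), hence is at most k. Smoothness of F may fail on |z| = 1. That circle is null and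
    F is locally Lipschitz away from p, so the pointwise derivatives off the circle are the
    distributional ones across it. Continuity of the inverse comes from compactness of the
    sphere. *)

Definition cabs (R : realType) (z : cplx R) : R := Normc.normc z.

(** * The real-valued modulus and the topology of the complex plane *)

Section ComplexModulus.
Variable R : realType.
Implicit Types (z u : cplx R) (x : R).

(** The norm of [cplx R] takes values in [cplx R], whose order is partial. Estimates are carried out
    on the real number [cabs z], and this identity converts between the two. *)
Lemma normE z : `|z| = ((cabs z)%:C : cplx R).
Proof. by []. Qed.

Lemma cabs_ge0 z : 0 <= cabs z.
Proof. by case: z => a b; rewrite /cabs /= sqrtr_ge0. Qed.

Lemma cabs0 : cabs (0 : cplx R) = 0.
Proof. exact: Normc.normc0. Qed.

Lemma cabs1 : cabs (1 : cplx R) = 1.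
Proof. exact: Normc.normc1. Qed.

Lemma cabsM z u : cabs (z * u) = cabs z * cabs u.
Proof. exact: Normc.normcM. Qed.

Lemma cabsV z : cabs z^-1 = (cabs z)^-1.
Proof. exact: Normc.normcV. Qed.

Lemma cabsX z n : cabs (z ^+ n) = cabs z ^+ n.
Proof. by elim: n => [|n IH]; rewrite ?expr0 ?cabs1 // !exprS cabsM IH. Qed.

Lemma cabsN z : cabs (- z) = cabs z.
Proof. by case: z => a b; rewrite /cabs /= !sqrrN. Qed.

Lemma cabsB z u : cabs (z - u) = cabs (u - z).
Proof. by rewrite -cabsN opprB. Qed.

Lemma cabsD z u : cabs (z + u) <= cabs z + cabs u.
Proof.
rewrite -lecR; have := ler_normD z u; rewrite !normE => /le_trans; apply.
by rewrite -rmorphD.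
Qed.

Lemma cabs_triangle v z u : cabs (z - u) <= cabs (z - v) + cabs (v - u).
Proof. by rewrite -[z - u](subrKA v) cabsD. Qed.

Lemma cabs_sub z u : cabs z - cabs u <= cabs (z - u).
Proof. by rewrite lerBlDr -{1}[z](subrK u) cabsD. Qed.

Lemma cabs_dist z u : `|cabs z - cabs u| <= cabs (z - u).
Proof. by rewrite ler_norml lerNl opprB cabs_sub andbT cabsB cabs_sub. Qed.

Lemma cabs_eq0 z : (cabs z == 0) = (z == 0).
Proof.
apply/eqP/eqP => [/Normc.eq0_normc //|->]; exact: cabs0.
Qed.

Lemma cabs_gt0 z : (0 < cabs z) = (z != 0).
Proof. by rewrite lt_def cabs_ge0 andbT cabs_eq0. Qed.

Lemma cabs_conj z : cabs (conjc z) = cabs z.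
Proof. by case: z => a b; rewrite /cabs /= sqrrN. Qed.

Lemma realD x y : ((x + y)%:C : cplx R) = x%:C + y%:C.
Proof. exact: rmorphD. Qed.

Lemma realM x y : ((x * y)%:C : cplx R) = x%:C * y%:C.
Proof. exact: rmorphM. Qed.

Lemma realBM x y t : ((x - y * t)%:C : cplx R) = x%:C - y%:C * t%:C.
Proof. by rewrite rmorphB rmorphM. Qed.

Lemma cabs_real x : cabs (x%:C : cplx R) = `|x|.
Proof. by rewrite /cabs /= expr0n addr0 sqrtr_sqr. Qed.

Lemma sqr_cabs z : cabs z ^+ 2 = complex.Re z ^+ 2 + complex.Im z ^+ 2.
Proof. by case: z => a b; rewrite /cabs /= sqr_sqrtr // addr_ge0 ?sqr_ge0. Qed.

Lemma Re_le_cabs z : `|complex.Re z| <= cabs z.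
Proof.
by rewrite -ler_sqr ?nnegrE ?cabs_ge0 // sqr_cabs real_normK ?num_real //
  lerDl sqr_ge0.
Qed.

Lemma Im_le_cabs z : `|complex.Im z| <= cabs z.
Proof.
by rewrite -ler_sqr ?nnegrE ?cabs_ge0 // sqr_cabs real_normK ?num_real //
  lerDr sqr_ge0.
Qed.

Lemma cabs_le_ReIm z : cabs z <= `|complex.Re z| + `|complex.Im z|.
Proof.
rewrite -ler_sqr ?nnegrE ?cabs_ge0 ?addr_ge0 //.
rewrite sqr_cabs sqrrD !real_normK ?num_real // addrAC lerDl.
by rewrite mulrn_wge0 // mulr_ge0.
Qed.

Lemma ReD z u : complex.Re (z + u) = complex.Re z + complex.Re u.
Proof. by case: z u => [? ?] [? ?]. Qed.

Lemma ImD z u : complex.Im (z + u) = complex.Im z + complex.Im u.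
Proof. by case: z u => [? ?] [? ?]. Qed.

Lemma ReB z u : complex.Re (z - u) = complex.Re z - complex.Re u.
Proof. by case: z u => [? ?] [? ?]. Qed.

Lemma ImB z u : complex.Im (z - u) = complex.Im z - complex.Im u.
Proof. by case: z u => [? ?] [? ?]. Qed.

Lemma conjD z u : (conjc (z + u) : cplx R) = conjc z + conjc u.
Proof. by case: z u => [? ?] [? ?]; congr (_ +i* _); rewrite opprD. Qed.

Lemma conjN z : (conjc (- z) : cplx R) = - conjc z.
Proof. by case: z. Qed.

Lemma conjB z u : (conjc (z - u) : cplx R) = conjc z - conjc u.
Proof. by rewrite conjD conjN. Qed.

Lemma conjM z u : (conjc (z * u) : cplx R) = conjc z * conjc u.
Proof. exact: (rmorphM (@conjc R)). Qed.

Lemma conjV z : (conjc z^-1 : cplx R) = (conjc z)^-1.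
Proof. exact: (fmorphV (@conjc R)). Qed.

Lemma conj_real x : (conjc x%:C : cplx R) = x%:C.
Proof. by congr (_ +i* _); rewrite oppr0. Qed.

Lemma conj1 : (conjc (1 : cplx R) : cplx R) = 1.
Proof. exact: conj_real. Qed.

Lemma mul_conj z : z * conjc z = ((cabs z ^+ 2)%:C : cplx R).
Proof.
rewrite sqr_cabs; case: z => a b /=; congr (_ +i* _); first by rewrite mulrN opprK -!expr2.
by rewrite mulrN addrC mulrC subrr.
Qed.

Lemma diskE z : disk z = (cabs z < 1) :> Prop.
Proof. by rewrite /disk /= normE -ltcR. Qed.

(** Balls of [cplx R] have radii in [cplx R]; positivity forces the imaginary part of a radius to
    vanish, so real radii suffice. *)
Lemma nbhs_cplx z (P : set (cplx R)) :
  nbhs z P <-> exists2 d : R, 0 < d & forall y, cabs (y - z) < d -> P y.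
Proof.
split=> [/nbhs_ballP [e /= e0 eP]|[d d0 dP]].
  have e0' : 0 < complex.Re e by move: e0; rewrite ltcE => /andP[].
  exists (complex.Re e) => // y yd; apply: eP; rewrite /ball /= normE.
  move: e0; rewrite ltcE => /andP[/eqP Ie _].
  by rewrite ltcE /= Ie eqxx cabsB.
apply/nbhs_ballP; exists (d%:C : cplx R); first by rewrite /= ltcR.
by move=> y; rewrite /ball /= normE ltcR cabsB => /dP.
Qed.

Lemma continuous_cplx (f : cplx R -> cplx R) z :
  {for z, continuous f} <->
  forall e : R, 0 < e -> exists2 d : R, 0 < d &
    forall y, cabs (y - z) < d -> cabs (f y - f z) < e.
Proof.
split=> [fc e e0|fc P /nbhs_cplx [e /fc [d d0 dP] eP]].
  have : nbhs (f z) [set w | cabs (w - f z) < e] by apply/nbhs_cplx; exists e.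
  by move=> /fc /nbhs_cplx [d d0 dP]; exists d.
by apply/nbhs_cplx; exists d => // y /dP; exact: eP.
Qed.

End ComplexModulus.

(** * Second-order expansion of power series *)

Section PowerSeries.
Variable R : realType.
Implicit Types (z u : cplx R) (h : cplx R -> cplx R).

Lemma cvg_cplxP (s : nat -> cplx R) (l : cplx R) :
  s @ \oo --> l <->
  forall e : R, 0 < e -> \forall n \near \oo, cabs (s n - l) < e.
Proof.
split=> [sl e e0|sl P /nbhs_cplx [e e0 eP]].
  by apply: (sl [set w | cabs (w - l) < e]); apply/nbhs_cplx; exists e.
by move: (sl e e0); apply: filterS => n; exact: eP.
Qed.

Lemma cvg_ReIm (s : nat -> cplx R) (x y : R) :
  (fun n => complex.Re (s n)) @ \oo --> x ->
  (fun n => complex.Im (s n)) @ \oo --> y ->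
  s @ \oo --> (x +i* y : cplx R).
Proof.
move=> /cvgrPdist_lt sx /cvgrPdist_lt sy; apply/cvg_cplxP => e e0.
have e2 : 0 < e / 2 by rewrite divr_gt0.
near=> n; apply: le_lt_trans (cabs_le_ReIm _) _.
rewrite ReB ImB /= [e]splitr; apply: ltrD; rewrite distrC; near: n.
  exact: sx.
exact: sy.
Unshelve. all: by end_near. Qed.

(** The Taylor remainder of order two of the monomial z^n. Its real counterpart below is the same
    expression at r = |z|, d >= |u|, and serves as a majorant. *)
Definition power_series_remainder n (z u : cplx R) : cplx R :=
  (z + u) ^+ n - z ^+ n - n%:R * z ^+ n.-1 * u.

Definition power_series_remainder_bound n (r d : R) : R :=
  (r + d) ^+ n - r ^+ n - n%:R * r ^+ n.-1 * d.

Lemma remainder_recurrence (K : comPzRingType) (x y : K) n :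
  (x + y) ^+ n.+1 - x ^+ n.+1 - n.+1%:R * x ^+ n * y =
  (x + y) * ((x + y) ^+ n - x ^+ n - n%:R * x ^+ n.-1 * y)
    + n%:R * x ^+ n.-1 * y ^+ 2.
Proof.
case: n => [|n]; first by rewrite /= !expr0 !expr1; ring.
by rewrite /= -(natr1 n.+1) !exprS; ring.
Qed.

Lemma power_series_remainder_bound_ge0 n (r d : R) : 0 <= r -> 0 <= d ->
  0 <= power_series_remainder_bound n r d.
Proof.
move=> r0 d0; rewrite /power_series_remainder_bound.
elim: n => [|n IH]; first by rewrite !expr0 !mul0r subrr subr0.
rewrite [n.+1.-1]/= remainder_recurrence; apply: addr_ge0.
  by apply: mulr_ge0 => //; rewrite addr_ge0.
by rewrite !mulr_ge0 ?exprn_ge0.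
Qed.

(* The remainder is u^2 times a polynomial with nonnegative coefficients in z and u. *)
Lemma power_series_remainderP n z u (d : R) : 0 < d -> cabs u <= d ->
  cabs (power_series_remainder n z u) * d ^+ 2 <=
  cabs u ^+ 2 * power_series_remainder_bound n (cabs z) d.
Proof.
move=> d0 ud.

elim: n => [|n IH].
  rewrite /power_series_remainder /power_series_remainder_bound.
  by rewrite !expr0 !subrr !mul0r !subrr cabs0 mul0r mulr0.
rewrite /power_series_remainder /power_series_remainder_bound.
rewrite !remainder_recurrence -/(power_series_remainder n z u).
rewrite -/(power_series_remainder_bound n (cabs z) d).
apply: (@le_trans _ _ ((cabs z + d) * cabs (power_series_remainder n z u) * d ^+ 2
   + n%:R * cabs z ^+ n.-1 * cabs u ^+ 2 * d ^+ 2)).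
  rewrite -mulrDl; apply: ler_wpM2r; first exact: sqr_ge0.
  apply: le_trans (cabsD _ _) _.
  rewrite !cabsM; apply: lerD.
    apply: ler_wpM2r; first exact: cabs_ge0.
    by apply: le_trans (cabsD _ _) _; rewrite lerD2l.
  rewrite !cabsX -[n%:R in leLHS]/(n%:R : cplx R).
  have -> : (n%:R : cplx R) = ((n%:R : R)%:C : cplx R) by rewrite rmorph_nat.
  by rewrite cabs_real normr_nat.
rewrite mulrDr; apply: lerD.
  rewrite -[leLHS]mulrA [leRHS]mulrCA; apply: ler_wpM2l => //.
  by rewrite addr_ge0 ?cabs_ge0 ?(ltW d0).
by rewrite -[leLHS]mulrA [leLHS]mulrC -[leLHS]mulrA [d ^+ 2 * _]mulrC.
Qed.

Lemma cvg_cplx_bounded (s : nat -> cplx R) (l : cplx R) :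
  s @ \oo --> l -> exists M : R, forall n, cabs (s n) <= M.
Proof.
move=> /cvg_cplxP /(_ 1 ltr01) [m _ sm].
exists (cabs l + 1 + \sum_(i < m) cabs (s i)) => n.
have S0 : 0 <= \sum_(i < m) cabs (s i) by apply: sumr_ge0 => i _; exact: cabs_ge0.
case: (leqP m n) => [/sm /= nm|nm].
  rewrite -[leLHS]addr0; apply: lerD => //.
  by rewrite -lerBlDl; apply: le_trans (cabs_sub _ _) (ltW nm).
rewrite (bigD1 (Ordinal nm)) //= addrCA lerDl !addr_ge0 ?cabs_ge0 //.
by apply: sumr_ge0 => i _; exact: cabs_ge0.
Qed.

Lemma cabs_sum (I : Type) (r : seq I) (P : pred I) (F : I -> cplx R) :
  cabs (\sum_(i <- r | P i) F i) <= \sum_(i <- r | P i) cabs (F i).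
Proof.
elim/big_ind2 : _ => //; first by rewrite cabs0.
by move=> x1 x2 y1 y2 hx hy; apply: le_trans (cabsD _ _) _; exact: lerD.
Qed.

(** Real and imaginary parts are absolutely convergent real series, dominated by the geometric
    one. *)
Lemma dominated_series_cvg (c : nat -> cplx R) (K q : R) :
  0 <= q < 1 -> (forall n, cabs (c n) <= K * q ^+ n) ->
  exists l : cplx R, [series c n]_n @ \oo --> l.
Proof.
move=> /andP[q0 q1] cK.
have real (f : cplx R -> R) : (forall z, `|f z| <= cabs z) ->
    cvgn (series (fun n => f (c n))).
  move=> fle; apply: normed_cvg.
  apply: (@series_le_cvg _ _ (geometric K q)).
  - by move=> n; exact: normr_ge0.
  - by move=> n; exact: le_trans (cabs_ge0 _) (cK n).
  - by move=> n; apply: le_trans (fle _) (cK n).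
  by apply: is_cvg_geometric_series; rewrite ger0_norm.
have RE := real _ (@Re_le_cabs R); have IM := real _ (@Im_le_cabs R).
exists (limn (series (fun n => complex.Re (c n))) +i*
        limn (series (fun n => complex.Im (c n)))).
have RS n : complex.Re (\sum_(0 <= i < n) c i) = \sum_(0 <= i < n) complex.Re (c i).
  by elim/big_ind2 : _ => // x1 x2 y1 y2 <- <-; rewrite ReD.
have IS n : complex.Im (\sum_(0 <= i < n) c i) = \sum_(0 <= i < n) complex.Im (c i).
  by elim/big_ind2 : _ => // x1 x2 y1 y2 <- <-; rewrite ImD.
apply: cvg_ReIm.
  by under eq_fun do rewrite RS.
by under eq_fun do rewrite IS.
Qed.

(** Convergence at a point r0 > |z| + d bounds a_n r0^n, so the remainders of the monomials, being
    at most r^n |u|^2/d^2 with r = |z| + d < r0, sum to a geometric series times |u|^2. *)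
Lemma power_series_second_order (a : nat -> cplx R) h z :
  power_series_on_disk a h -> disk z ->
  exists D : cplx R, exists C d : R, 0 < d /\
    forall u, cabs u <= d -> cabs (h (z + u) - h z - D * u) <= C * cabs u ^+ 2.
Proof.
move=> ah; rewrite diskE => z1.
(* Three equal steps lead from |z| to 1: r is the first stop, r0 the second, and r0 < 1 leaves room
   for convergence at r0. *)
pose d := (1 - cabs z) / 3; pose r := cabs z + d; pose r0 := r + d.
have d0 : 0 < d by rewrite divr_gt0 // subr_gt0.
have rp : 0 <= r by rewrite addr_ge0 ?cabs_ge0 ?(ltW d0).
have r0p : 0 < r0 by rewrite ltr_wpDl.
have r01 : r0 < 1 by rewrite /r0 /r /d; lra.
pose q := r / r0.
have q01 : 0 <= q < 1.
  by rewrite divr_ge0 ?(ltW r0p) //= ltr_pdivrMr // mul1r ltrDl.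
have [M aM] : exists M : R, forall n, cabs (a n.+1) * r0 ^+ n.+1 <= M.
  have /ah ar0 : disk (r0%:C : cplx R) by rewrite diskE cabs_real gtr0_norm.
  have /cvg_series_cvg_0 : cvgn (series (fun n => a n.+1 * (r0%:C : cplx R) ^+ n.+1)).
    by apply/cvg_ex; eexists; exact: ar0.
  move=> /cvg_cplx_bounded [M aM]; exists M => n.
  by have := aM n; rewrite cabsM cabsX cabs_real gtr0_norm.
have M0 : 0 <= M by apply: le_trans (aM 0); rewrite mulr_ge0 ?cabs_ge0 ?exprn_ge0 ?(ltW r0p).
have ale n : cabs (a n.+1) * r ^+ n.+1 <= M * q ^+ n.
  apply: (@le_trans _ _ (M * q ^+ n.+1)).
    rewrite /q exprMn exprVn mulrA ler_pdivlMr ?exprn_gt0 //.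
    by rewrite mulrAC ler_wpM2r ?exprn_ge0.
  by rewrite ler_wpM2l // exprS ler_piMl ?exprn_ge0; case/andP: q01 => // _ /ltW.
have bound_le n : power_series_remainder_bound n (cabs z) d <= r ^+ n.
  rewrite /power_series_remainder_bound -addrA gerDl -opprD oppr_le0.
  by apply: addr_ge0; [|apply: mulr_ge0; [apply: mulr_ge0|exact: ltW]];
    rewrite ?exprn_ge0 ?cabs_ge0.
(* Nonnegativity of the majorant remainder bounds the linear term by r^n, which makes the
   differentiated series converge. *)
have bound_ge n : n%:R * cabs z ^+ n.-1 * d <= r ^+ n.
  have := power_series_remainder_bound_ge0 n (cabs_ge0 z) (ltW d0).
  rewrite /power_series_remainder_bound -/r subr_ge0 => /le_trans; apply.
  by rewrite gerBl exprn_ge0 ?cabs_ge0.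
have [D cD] : exists D : cplx R, [series n.+1%:R * a n.+1 * z ^+ n]_n @ \oo --> D.
  apply: (@dominated_series_cvg _ (M / d) q) => // n.
  rewrite [M / d * _]mulrAC ler_pdivlMr // !cabsM cabsX.
  have -> : (n.+1%:R : cplx R) = ((n.+1%:R : R)%:C : cplx R) by rewrite rmorph_nat.
  rewrite cabs_real normr_nat [n.+1%:R * _]mulrC -!mulrA; apply: le_trans (ale n).
  by apply: ler_wpM2l; [exact: cabs_ge0 | rewrite mulrA; exact: bound_ge].
exists D, (M / (1 - q) / d ^+ 2), d; split=> // u ud.
have zu1 : disk (z + u).
  rewrite diskE; apply: le_lt_trans (cabsD _ _) _; apply: le_lt_trans r01.
  by rewrite /r0 /r -addrA lerD2l (le_trans ud) // lerDl ltW.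
have partial_le n : cabs (\sum_(0 <= i < n) a i.+1 * (z + u) ^+ i.+1
   - \sum_(0 <= i < n) a i.+1 * z ^+ i.+1
   - (\sum_(0 <= i < n) i.+1%:R * a i.+1 * z ^+ i) * u) <=
   M / (1 - q) / d ^+ 2 * cabs u ^+ 2.
  rewrite mulr_suml -!sumrB; apply: le_trans (cabs_sum _ _ _) _.
  apply: (@le_trans _ _ (\sum_(0 <= i < n) (M * q ^+ i) * (cabs u ^+ 2 / d ^+ 2))).
    apply: ler_sum => i _.
    have -> : a i.+1 * (z + u) ^+ i.+1 - a i.+1 * z ^+ i.+1
       - i.+1%:R * a i.+1 * z ^+ i * u = a i.+1 * power_series_remainder i.+1 z u.
      by rewrite /power_series_remainder [i.+1.-1]/=; ring.
    rewrite [leRHS]mulrA ler_pdivlMr ?exprn_gt0 // cabsM -[leLHS]mulrA.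
    apply: (@le_trans _ _ (cabs (a i.+1) * (cabs u ^+ 2 * r ^+ i.+1))).
      apply: ler_wpM2l; first exact: cabs_ge0.
      apply: le_trans (power_series_remainderP _ _ d0 ud) _.
      by apply: ler_wpM2l; [exact: sqr_ge0 | exact: bound_le].
    by rewrite mulrCA mulrC; apply: ler_wpM2r; [exact: sqr_ge0 | exact: ale].
  rewrite -mulr_suml -mulr_sumr -[leRHS]mulrA [_^-1 * _]mulrC.
  apply: ler_wpM2r; first by rewrite divr_ge0 ?sqr_ge0.
  case/andP: q01 => q0 q1; apply: ler_wpM2l => //.
  have q10 : 0 < 1 - q by rewrite subr_gt0.
  rewrite -[_^-1]mul1r ler_pdivlMr // mulrC big_mkord -[1 - q]opprB mulNr -subrX1.
  by rewrite opprB gerBl exprn_ge0.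
apply/ler_addgt0Pr => e e0.
(* The estimate on partial sums passes to the limit with three errors, for h (z + u), h z and D,
   entering with weights 1, 1 and |u|. *)
have e0' : 0 < e / (2 + cabs u) by rewrite divr_gt0 // ltr_wpDr ?cabs_ge0.
have /cvg_cplxP /(_ _ e0') [n1 _ h1] := ah _ zu1.
have /cvg_cplxP /(_ _ e0') [n2 _ h2] : [series a n.+1 * z ^+ n.+1]_n @ \oo --> h z.
  by apply: ah; rewrite diskE.
have /cvg_cplxP /(_ _ e0') [n3 _ h3] := cD.
pose n := maxn n1 (maxn n2 n3).
have {}h1 := h1 n (leq_maxl _ _).
have {}h2 := h2 n (leq_trans (leq_maxl _ _) (leq_maxr _ _)).
have {}h3 := h3 n (leq_trans (leq_maxr _ _) (leq_maxr _ _)).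
have := partial_le n; move: h1 h2 h3; rewrite /= /series /=.
set s1 := \sum_(0 <= i < n) _; set s2 := \sum_(0 <= i < n) _.
set s3 := \sum_(0 <= i < n) _; set e' := e / _ => h1 h2 h3 s123.
have -> : h (z + u) - h z - D * u = (s1 - s2 - s3 * u) +
   ((h (z + u) - s1) - (h z - s2) - (D - s3) * u) by ring.
apply: le_trans (cabsD _ _) _; apply: lerD => //.
apply: le_trans (cabsD _ _) _; rewrite cabsN cabsM.
have -> : e = (e' + e') + e' * cabs u.
  by rewrite /e'; field; rewrite gt_eqF // ltr_wpDr ?cabs_ge0.
apply: lerD; last by apply: ler_wpM2r; [exact: cabs_ge0 | rewrite cabsB ltW].
apply: le_trans (cabsD _ _) _; rewrite cabsN cabsB [cabs (h z - _)]cabsB.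
by apply: lerD; exact: ltW.
Qed.
End PowerSeries.

(** * Real differentials *)

(* [real_diff F z a b] says that F is real differentiable at z, with
   F_z = a and F_zbar = b. *)
Definition real_diff (R : realType) (F : cplx R -> cplx R) (z a b : cplx R) :=
  forall e : R, 0 < e -> exists2 d : R, 0 < d & forall u, cabs u < d ->
    cabs (F (z + u) - F z - (a * u + b * conjc u)) <= e * cabs u.

Section RealDifferential.
Variable R : realType.
Implicit Types (z u a b c d : cplx R) (F G : cplx R -> cplx R).

(** Links [real_diff] with [derive1], in terms of which the hypothesis on h' and g' is written. *)
Lemma real_diff_derive1 F z a : real_diff F z a 0 -> derive1 F z = a.
Proof.
move=> Fd; rewrite /derive1; apply/cvg_lim; first exact: norm_hausdorff.
move=> P /nbhs_cplx [e e0 eP].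
have e2 : 0 < e / 2 by rewrite divr_gt0.
have [d d0 dF] := Fd _ e2.
rewrite /nbhs /=; apply/nbhs_cplx; exists d => // u; rewrite subr0 => ud u0.
apply: eP; apply: (@le_lt_trans _ _ (e / 2)); last by rewrite ltr_pdivrMr // ltr_pMr // ltr1n.
have cu0 : 0 < cabs u by rewrite cabs_gt0.
rewrite -(ler_pM2r cu0) -cabsM; apply: le_trans (dF _ ud).
rewrite mul0r addr0 [u + z]addrC /GRing.scale /= mulrBl.
by rewrite -mulrA [X in _ * X]mulrC mulrA mulVf // mul1r.
Qed.

Lemma real_diff_power_series (s : nat -> cplx R) (h : cplx R -> cplx R) z :
  power_series_on_disk s h -> disk z -> real_diff h z (derive1 h z) 0.
Proof.
move=> sh z1; have [D [C [d [d0 dh]]]] := power_series_second_order sh z1.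
suff hD : real_diff h z D 0 by rewrite (real_diff_derive1 hD).
move=> e e0; have C1 : 0 < `|C| + 1 by rewrite ltr_wpDl.
exists (Num.min d (e / (`|C| + 1))); first by rewrite lt_min d0 divr_gt0.
move=> u; rewrite lt_min => /andP[ud ue].
rewrite mul0r addr0; apply: le_trans (dh _ (ltW ud)) _.
rewrite expr2 mulrA; apply: ler_wpM2r; first exact: cabs_ge0.
apply: (@le_trans _ _ ((`|C| + 1) * cabs u)); last by rewrite mulrC -ler_pdivlMr // ltW.
apply: ler_wpM2r; first exact: cabs_ge0.
by apply: le_trans (ler_norm _) _; rewrite lerDl.
Qed.

Lemma real_diff_near F G z a b (d : R) : 0 < d ->
  (forall u, cabs u < d -> F (z + u) = G (z + u)) ->
  real_diff G z a b -> real_diff F z a b.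
Proof.
move=> d0 FG Gd e e0; have [d' d'0 dG] := Gd e e0.
exists (Num.min d d'); first by rewrite lt_min d0.
move=> u; rewrite lt_min => /andP[ud ud'].
have Fz : F z = G z by have := FG 0; rewrite cabs0 addr0; exact.
by rewrite FG // Fz dG.
Qed.

Lemma real_diff_id z : real_diff id z 1 0.
Proof.
move=> e e0; exists 1 => // u _.
have -> : z + u - z - (1 * u + 0 * conjc u) = 0 by ring.
by rewrite cabs0 mulr_ge0 ?cabs_ge0 // ltW.
Qed.

Lemma real_diff_cst c z : real_diff (fun=> c) z 0 0.
Proof.
move=> e e0; exists 1 => // u _.
have -> : c - c - (0 * u + 0 * conjc u) = 0 by ring.
by rewrite cabs0 mulr_ge0 ?cabs_ge0 // ltW.
Qed.

Lemma real_diffD F G z a b c d : real_diff F z a b -> real_diff G z c d ->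
  real_diff (fun w => F w + G w) z (a + c) (b + d).
Proof.
move=> Fd Gd e e0; have e2 : 0 < e / 2 by rewrite divr_gt0.
have [d1 d10 dF] := Fd _ e2; have [d2 d20 dG] := Gd _ e2.
exists (Num.min d1 d2); first by rewrite lt_min d10.
move=> u; rewrite lt_min => /andP[ud1 ud2].
have -> : F (z + u) + G (z + u) - (F z + G z) - ((a + c) * u + (b + d) * conjc u)
  = (F (z + u) - F z - (a * u + b * conjc u))
    + (G (z + u) - G z - (c * u + d * conjc u)) by ring.
apply: le_trans (cabsD _ _) _; rewrite [e]splitr mulrDl.
by apply: lerD; [exact: dF | exact: dG].
Qed.

Lemma real_diff_conj F z a b : real_diff F z a b ->
  real_diff (fun w => conjc (F w)) z (conjc b) (conjc a).
Proof.
move=> Fd e e0; have [d d0 dF] := Fd _ e0; exists d => // u /dF.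
rewrite -[cabs (F _ - _ - _)]cabs_conj conjB conjB conjD !conjM conjcK.
by rewrite [conjc a * _ + _]addrC.
Qed.

Lemma real_diff_bounded F z a b : real_diff F z a b ->
  exists C d : R, [/\ 0 < C, 0 < d &
    forall u, cabs u < d -> cabs (F (z + u) - F z) <= C * cabs u].
Proof.
move=> /(_ 1 ltr01) [d d0 dF]; exists (1 + cabs a + cabs b), d; split=> //.
  by rewrite -addrA ltr_pwDl // addr_ge0 ?cabs_ge0.
move=> u /dF Fu.
rewrite -[F (z + u) - F z](subrK (a * u + b * conjc u)).
apply: le_trans (cabsD _ _) _; rewrite -[1 + _ + _]addrA [leRHS]mulrDl; apply: lerD => //.
by apply: le_trans (cabsD _ _) _; rewrite !cabsM cabs_conj mulrDl.
Qed.

Lemma real_diff_comp F G z a b c d :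
  real_diff F z a b -> real_diff G (F z) c d ->
  real_diff (fun w => G (F w)) z (c * a + d * conjc b) (c * b + d * conjc a).
Proof.
move=> Fd Gd e e0; have [C [d1 [C0 d10 FC]]] := real_diff_bounded Fd.
have e1 : 0 < e / 2 / C by rewrite !divr_gt0.
have [d2 d20 dG] := Gd _ e1.
have K0 : 0 < cabs c + cabs d + 1 by rewrite ltr_wpDl // addr_ge0 ?cabs_ge0.
have e2 : 0 < e / 2 / (cabs c + cabs d + 1) by rewrite !divr_gt0.
have [d3 d30 dF] := Fd _ e2.
exists (Num.min d1 (Num.min d3 (d2 / C))); first by rewrite !lt_min d10 d30 divr_gt0.
move=> u; rewrite !lt_min => /and3P[ud1 ud3]; rewrite ltr_pdivlMr // => ud2.
have {FC}Fu := FC _ ud1; have {}dF := dF _ ud3.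
pose v := F (z + u) - F z; pose w := v - (a * u + b * conjc u).
have /dG : cabs v < d2 by apply: le_lt_trans Fu _; rewrite mulrC.
rewrite [F z + v]addrC subrK => dGv.
(* With v the increment of F and w its deviation from the differential, the error is that of G at v
   plus the differential of G applied to w. *)
have -> : G (F (z + u)) - G (F z)
    - ((c * a + d * conjc b) * u + (c * b + d * conjc a) * conjc u)
  = (G (F (z + u)) - G (F z) - (c * v + d * conjc v)) + (c * w + d * conjc w).
  have -> : conjc w = conjc v - (conjc a * conjc u + conjc b * u) :> cplx R.
    by move: (v) => v' in w *; rewrite /w conjB conjD !conjM conjcK.
  by rewrite /w; ring.
apply: le_trans (cabsD _ _) _; rewrite [e]splitr mulrDl; apply: lerD.
  apply: le_trans dGv _; rewrite -mulrA; apply: ler_wpM2l.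
    by rewrite divr_ge0 // ltW.
  by rewrite mulrC ler_pdivrMr // mulrC.
apply: le_trans (cabsD _ _) _; rewrite !cabsM cabs_conj -mulrDl.
apply: (@le_trans _ _ ((cabs c + cabs d + 1) * cabs w)).
  by apply: ler_wpM2r; [exact: cabs_ge0 | rewrite lerDl].
by rewrite mulrC -ler_pdivlMr // mulrAC.
Qed.

Lemma real_diffM c F z a b : real_diff F z a b ->
  real_diff (fun w => c * F w) z (c * a) (c * b).
Proof.
move=> Fd.
have cd : real_diff (fun w => c * w) (F z) c 0.
  move=> e e0; exists 1 => // u _.
  have -> : c * (F z + u) - c * F z - (c * u + 0 * conjc u) = 0 by ring.
  by rewrite cabs0 mulr_ge0 ?cabs_ge0 // ltW.
by have := real_diff_comp Fd cd; rewrite !mul0r !addr0.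
Qed.

Lemma real_diff_inv z : z != 0 -> real_diff (fun w => w^-1) z (- z ^- 2) 0.
Proof.
move=> z0; have cz : 0 < cabs z by rewrite cabs_gt0.
move=> e e0; exists (Num.min (cabs z / 2) (e * cabs z ^+ 3 / 2)).
  by rewrite lt_min divr_gt0 // divr_gt0 // mulr_gt0 // exprn_gt0.
move=> u; rewrite lt_min => /andP[uz ue].
have zu : cabs z / 2 < cabs (z + u).
  have := cabs_sub z (- u); rewrite cabsN opprK; apply: lt_le_trans.
  by rewrite ltrBrDl -ltrBrDr [X in _ < X - _]splitr addrK.
have zu0 : z + u != 0 by rewrite -cabs_gt0 (le_lt_trans _ zu) // divr_ge0 ?cabs_ge0.
(* The error is exactly quadratic in u, and |z + u| > |z|/2 keeps its denominator away from 0. *)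
have -> : (z + u)^-1 - z^-1 - (- z ^- 2 * u + 0 * conjc u) = u * (u / (z ^+ 2 * (z + u))).
  by field; rewrite z0 zu0.
rewrite cabsM mulrC; apply: ler_wpM2r; first exact: cabs_ge0.
rewrite cabsM cabsV cabsM cabsX ler_pdivrMr ?mulr_gt0 ?exprn_gt0 ?cabs_gt0 //.
apply: le_trans (ltW ue) _; rewrite -mulrA; apply: ler_wpM2l; first exact: ltW.
rewrite exprSr -mulrA; apply: ler_wpM2l; first by rewrite exprn_ge0 ?cabs_ge0.
exact: ltW.
Qed.

End RealDifferential.

(** * Differential of log |z| *)

Section Logarithm.
Variable R : realType.
Implicit Types (z u a b : cplx R).

(** Both sides come from ln (1 + x) <= x: at x = s for the upper bound, and at 1 + x = 1/(1 + s) for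
    the lower one. *)
Lemma ln_second_order (s : R) : `|s| <= 1 / 2 -> `|ln (1 + s) - s| <= 2 * s ^+ 2.
Proof.
rewrite ler_norml => /andP[s1 s2].
have s0 : 0 < 1 + s by lra.
have up : ln (1 + s) <= s by apply: le_ln1Dx; lra.
have lo : - ln (1 + s) <= - s / (1 + s).
  have -> : - ln (1 + s) = ln (1 + (- s / (1 + s))).
    rewrite -lnV ?posrE //; congr ln; field; exact: lt0r_neq0.
  apply: le_ln1Dx; rewrite ltr_pdivlMr //; lra.
have lo2 : - s / (1 + s) <= - s + 2 * s ^+ 2 by rewrite ler_pdivrMr //; nra.
rewrite ler_norml; apply/andP; split; last first.
  by apply: (@le_trans _ _ 0); [lra | exact: mulr_ge0 (ler0n _ 2) (sqr_ge0 _)].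
by rewrite lerNl opprB; lra.
Qed.

(** Since Re w = (w + conj w)/2, both derivatives are half of 1/x. Composed with the real-valued
    |w|^2 this yields log |w|. *)
Lemma real_diff_ln_Re z (x := complex.Re z) : 0 < x ->
  real_diff (fun w : cplx R => (ln (complex.Re w))%:C : cplx R) z
    ((2 * x)^-1)%:C ((2 * x)^-1)%:C.
Proof.
move=> x0 e e0; exists (Num.min (x / 2) (e * x ^+ 2 / 2)).
  by rewrite lt_min !divr_gt0 // mulr_gt0 // exprn_gt0.
move=> u; rewrite lt_min => /andP[ux ue].
pose s := complex.Re u / x.
have s_le : `|s| <= cabs u / x.
  rewrite /s normrM normfV (gtr0_norm x0); apply: ler_wpM2r; last exact: Re_le_cabs.
  by rewrite invr_ge0 ltW.
have s2 : `|s| <= 1 / 2.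
  by apply: le_trans s_le _; rewrite ler_pdivrMr // mul1r mulrC ltW.
have s0 : 0 < 1 + s by move: s2; rewrite ler_norml => /andP[]; lra.
have -> : (ln (complex.Re (z + u)))%:C - (ln (complex.Re z))%:C
   - (((2 * x)^-1)%:C * u + ((2 * x)^-1)%:C * conjc u)
   = ((ln (1 + s) - s)%:C : cplx R).
  have -> : ln (complex.Re (z + u)) = ln x + ln (1 + s).
    rewrite -lnM ?posrE // ReD -/x; congr ln; rewrite /s; field.
    exact: lt0r_neq0.
  rewrite /s -/x; case: (u) => v w /=; congr (_ +i* _); last by ring.
  by field; exact: lt0r_neq0.
rewrite cabs_real; apply: le_trans (ln_second_order s2) _.
rewrite -real_normK ?num_real //.
apply: (@le_trans _ _ (2 * (cabs u / x) ^+ 2)).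
  by apply: ler_wpM2l => //; rewrite ler_sqr ?nnegrE // divr_ge0 ?cabs_ge0 // ltW.
rewrite expr_div_n mulrA ler_pdivrMr ?exprn_gt0 // [cabs u ^+ 2]expr2 [leLHS]mulrA [leRHS]mulrAC.
apply: ler_wpM2r; first exact: cabs_ge0.
by rewrite mulrC -ler_pdivlMr // ltW.
Qed.

Lemma real_diff_sqr_cabs z :
  real_diff (fun w : cplx R => (cabs w ^+ 2)%:C : cplx R) z (conjc z) z.
Proof.
move=> e e0; exists e => // u ue; rewrite -!mul_conj conjD.
have -> : (z + u) * (conjc z + conjc u) - z * conjc z - (conjc z * u + z * conjc u)
  = u * conjc u by ring.
by rewrite cabsM cabs_conj; apply: ler_wpM2r; [exact: cabs_ge0 | exact: ltW].
Qed.

(** Write log |w| = (1/2) log |w|^2 and apply the chain rule, which avoids differentiating the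
    square root in the modulus. *)
Lemma real_diff_ln_cabs z : z != 0 ->
  real_diff (fun w : cplx R => (ln (cabs w))%:C : cplx R) z
    (2 * z)^-1 (2 * conjc z)^-1.
Proof.
move=> z0; have cz : 0 < cabs z by rewrite cabs_gt0.
have c2 : 0 < complex.Re ((cabs z ^+ 2)%:C : cplx R) by rewrite /= exprn_gt0.
have := real_diffM (2^-1)%:C
  (real_diff_comp (real_diff_sqr_cabs z) (real_diff_ln_Re c2)).
have conj0 : (conjc z : cplx R) != 0 by rewrite -cabs_eq0 cabs_conj gt_eqF.
have e2 : (((2 * cabs z ^+ 2)^-1)%:C : cplx R) = (2 * (z * conjc z))^-1.
  by rewrite fmorphV rmorphM /= rmorph_nat mul_conj.
have e3 : ((2^-1)%:C : cplx R) = 2^-1 by rewrite fmorphV rmorph_nat.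
rewrite /= e2 e3 conjcK.
have -> : 2^-1 * ((2 * (z * conjc z))^-1 * conjc z + (2 * (z * conjc z))^-1 * conjc z)
  = (2 * z)^-1 :> cplx R by field; rewrite z0 conj0.
have -> : 2^-1 * ((2 * (z * conjc z))^-1 * z + (2 * (z * conjc z))^-1 * z)
  = (2 * conjc z)^-1 :> cplx R by field; rewrite z0 conj0.
apply: real_diff_near cz _ => u uz.
have zu0 : 0 < cabs (z + u).
  rewrite cabs_gt0; apply: contraTneq uz => /eqP; rewrite addr_eq0 => /eqP ->.
  by rewrite cabsN ltxx.
by rewrite lnXn // mulr2n -e3 -rmorphM; congr _%:C; field.
Qed.

End Logarithm.

(** * Bounding the derivatives by a Lipschitz constant *)

Section Dilatation.
Variable R : realType.
Implicit Types (z u a b : cplx R) (F : cplx R -> cplx R).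

(** The norm of the differential u |-> a u + b conj u is |a| + |b|, attained at the unit u for which
    a u and b conj u have the same argument, and it cannot exceed a local Lipschitz constant. *)
Lemma real_diff_lipschitz F z a b (k d : R) : 0 < d ->
  (forall u, cabs u < d -> cabs (F (z + u) - F z) <= k * cabs u) ->
  real_diff F z a b -> cabs a + cabs b <= k.
Proof.
move=> d0 Fk Fd.
have dir u : cabs u = 1 -> cabs (a * u + b * conjc u) <= k.
  move=> u1; apply/ler_addgt0Pr => e e0; have [d' d'0 dF] := Fd _ e0.
  pose t := Num.min d d' / 2.
  have m0 : 0 < Num.min d d' by rewrite lt_min d0.
  have t0 : 0 < t by rewrite divr_gt0.
  have tm : t < Num.min d d' by rewrite /t ltr_pdivrMr // ltr_pMr // ltr1n.
  have ctu : cabs (t%:C * u) = t by rewrite cabsM cabs_real u1 mulr1 gtr0_norm.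
  move: tm; rewrite -{1}ctu lt_min => /andP[/Fk h1]; rewrite ctu in h1 *.
  rewrite -{1}ctu => /dF; rewrite ctu => h2.
  rewrite -(ler_pM2r t0).
  have -> : cabs (a * u + b * conjc u) * t = cabs (a * (t%:C * u) + b * conjc (t%:C * u)).
    rewrite -{1}(gtr0_norm t0) -cabs_real -cabsM conjM conj_real.
    by congr cabs; ring.
  rewrite mulrDl -[X in cabs X](subrK (F (z + t%:C * u) - F z)).
  apply: le_trans (cabsD _ _) _; rewrite addrC; apply: lerD => //.
  by rewrite cabsB.
have [ab0|ab0] := eqVneq (a * conjc b) 0.
  have := dir 1 (cabs1 R); rewrite conj1 !mulr1.
  move/eqP: ab0; rewrite mulf_eq0 -[X in _ || X]cabs_eq0 cabs_conj cabs_eq0.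
  by case/orP => /eqP ->; rewrite cabs0 ?add0r ?addr0.
have c0 : 0 < cabs (a * conjc b) by rewrite cabs_gt0.
have [m mE] : exists m, m = cabs (a * conjc b) by eexists.
rewrite -mE in c0.
(* For u^2 = s the product of a u with the conjugate of b conj u is a conj(b) u^2 = |a b|, a
   nonnegative real, so the two summands are aligned. *)
pose s : cplx R := conjc (a * conjc b) / m%:C.
have cs : cabs s = 1.
  by rewrite /s cabsM cabs_conj -mE cabsV cabs_real gtr0_norm // divff // gt_eqF.
pose u : cplx R := sqrtC s.
have us : u ^+ 2 = s by rewrite sqrtCK.
have u1 : cabs u = 1.
  apply/eqP; rewrite -(@eqrXn2 _ 2) ?cabs_ge0 // -cabsX us cs expr1n //.
have uu : u * conjc u = 1 by rewrite mul_conj u1 expr1n.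
apply: le_trans (dir u u1).
rewrite -ler_sqr ?nnegrE ?addr_ge0 ?cabs_ge0 // le_eqVlt; apply/orP; left; apply/eqP.
apply: (@complexI R); rewrite -mul_conj conjD !conjM conjcK.
have -> : (a * u + b * conjc u) * (conjc a * conjc u + conjc b * u)
  = a * conjc a * (u * conjc u) + b * conjc b * (u * conjc u)
    + (a * conjc b * u ^+ 2 + conjc (a * conjc b * u ^+ 2)) :> cplx R.
  by rewrite expr2 !conjM conjcK; ring.
rewrite uu !mulr1 us !mul_conj.
have -> : a * conjc b * s = (cabs a * cabs b)%:C :> cplx R.
  rewrite /s mulrA mul_conj -mE.
  have -> : cabs a * cabs b = m by rewrite mE cabsM cabs_conj.
  by rewrite expr2 rmorphM mulfK // (fmorph_eq0 (real_complex R)) gt_eqF.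
by rewrite conj_real -!rmorphD; congr _%:C; ring.
Qed.

End Dilatation.

(** * A mean value inequality along segments *)

Section MeanValue.
Variable R : realType.

(** Stated for any normed module because it is applied both to functions on the line and, later, to
    functions on [R * R]. *)
Lemma is_derive_quotient (V : normedModType R) (f : V -> R) (x v : V) (D : R) :
  (forall e : R, 0 < e -> exists2 d : R, 0 < d & forall h : R, `|h| < d ->
     `|f (x + h *: v) - f x - D * h| <= e * `|h|) ->
  is_derive x v f D.
Proof.
move=> fD.
have cvD : h^-1 *: ((f \o shift x) (h *: v) - f x) @[h --> (0 : R)^'] --> D.
  apply/cvgrPdist_le => e e0; have [d d0 dF] := fD _ e0.
  rewrite /nbhs /= /dnbhs /within /=; apply/nbhs_ballP; exists d => // h /=.
  rewrite /ball /= sub0r normrN => hd h0.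
  have nh : 0 < `|h| by rewrite normr_gt0.
  rewrite distrC -(ler_pM2r nh) -normrM; apply: le_trans (dF _ hd).
  rewrite [h *: v + x]addrC /GRing.scale /= mulrBl.
  by rewrite -mulrA [X in _ * X]mulrC mulrA mulVf // mul1r.
apply: DeriveDef; first by apply/cvg_ex; exists D.
by apply/cvg_lim.
Qed.

(** The mean value theorem holds only for real functions, so F is projected on the direction e of
    its own increment: phi grows by |e|^2 on [0, 1] while its derivative is at most |e| L |v|. *)
Lemma real_diff_mean_value (F : cplx R -> cplx R) (z0 z1 : cplx R) (L : R) :
  (forall t : R, 0 <= t <= 1 -> exists a b : cplx R,
     real_diff F (z0 + t%:C * (z1 - z0)) a b /\ cabs a + cabs b <= L) ->
  cabs (F z1 - F z0) <= L * cabs (z1 - z0).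
Proof.
move=> Fd; pose v := z1 - z0; pose e := F z1 - F z0.
have L0 : 0 <= L.
  have [|a [b [_]]] := Fd 0; first by rewrite lexx ler01.
  by apply: le_trans; rewrite addr_ge0 ?cabs_ge0.
have [e0|e0] := eqVneq e 0; first by rewrite -/e e0 cabs0 mulr_ge0 ?cabs_ge0.
have ce : 0 < cabs e by rewrite cabs_gt0.
pose phi (t : R) := complex.Re (conjc e * F (z0 + t%:C * v)).
(* The range of t is a premise inside the existential so that [choice] yields a derivative function
   defined on all of R; the value 0 outside [0, 1] is a default. *)
have dphi (t : R) : exists D : R, 0 <= t <= 1 ->
    is_derive t (1 : R) phi D /\ `|D| <= cabs e * L * cabs v.
  have [t01|_] := boolP (0 <= t <= 1); last by exists 0.
  have [a [b [Fab abL]]] := Fd t t01.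
  exists (complex.Re (conjc e * (a * v + b * conjc v))) => _; split; last first.
    apply: le_trans (Re_le_cabs _) _; rewrite cabsM cabs_conj -mulrA.
    apply: ler_wpM2l; first exact: cabs_ge0.
    apply: le_trans (cabsD _ _) _; rewrite !cabsM cabs_conj -mulrDl.
    by apply: ler_wpM2r; first exact: cabs_ge0.
  apply: is_derive_quotient => eps eps0.
  have K0 : 0 < cabs e * cabs v + 1 by rewrite ltr_wpDl // mulr_ge0 ?cabs_ge0.
  have [d d0 dF] := Fab _ (divr_gt0 eps0 K0).
  exists (d / (cabs v + 1)); first by rewrite divr_gt0 // ltr_wpDl ?cabs_ge0.
  move=> h hd.
  have chv : cabs (h%:C * v) = `|h| * cabs v by rewrite cabsM cabs_real.
  have /dF : cabs (h%:C * v) < d.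
    rewrite chv; apply: le_lt_trans (_ : `|h| * (cabs v + 1) < d).
      by apply: ler_wpM2l => //; rewrite lerDl.
    by rewrite -ltr_pdivlMr // ltr_wpDl ?cabs_ge0.
  rewrite chv => hF.
  set q := F _ - _ - _ in hF.
  have -> : phi (t + h *: 1) - phi t - complex.Re (conjc e * (a * v + b * conjc v)) * h
     = complex.Re (conjc e * q).
    have ReZ (w : cplx R) : complex.Re w * h = complex.Re (w * h%:C).
      by case: w => w1 w2 /=; rewrite mulr0 subr0.
    rewrite /phi ReZ -!ReB; congr complex.Re; rewrite /q.
    have -> : z0 + (t + h *: 1)%:C * v = z0 + t%:C * v + h%:C * v :> cplx R.
      by rewrite -addrA -mulrDl -rmorphD /GRing.scale /= mulr1.
    by rewrite conjM conj_real; ring.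
  apply: le_trans (Re_le_cabs _) _; rewrite cabsM cabs_conj.
  apply: (@le_trans _ _ (cabs e * (eps / (cabs e * cabs v + 1) * (`|h| * cabs v)))).
    by apply: ler_wpM2l; first exact: cabs_ge0.
  rewrite [leLHS](_ : _ = eps * `|h| * (cabs e * cabs v / (cabs e * cabs v + 1))); last by ring.
  rewrite -[leRHS]mulr1; apply: ler_wpM2l; first by rewrite mulr_ge0 // ltW.
  by rewrite ler_pdivrMr // mul1r lerDl.
have [df dfP] := choice dphi.
have [||c] := @MVT_segment R phi df 0 1 ler01.
- by move=> x; rewrite in_itv /= => /andP[x0 x1]; have [] := dfP x; rewrite ?(ltW x0) ?(ltW x1).
- apply: derivable_within_continuous => x; rewrite in_itv /= => /dfP [H _].
  exact: ex_derive.
rewrite in_itv /= => c01; rewrite subr0 mulr1 => phiE.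
have : phi 1 - phi 0 = cabs e ^+ 2.
  rewrite /phi -ReB -mulrBr.
  have -> : z0 + (1 : R)%:C * v = z1 by rewrite rmorph1 mul1r /v addrC subrK.
  have -> : z0 + (0 : R)%:C * v = z0 by rewrite rmorph0 mul0r addr0.
  by rewrite mulrC mul_conj.
rewrite phiE => dE; have [_] := dfP c c01; rewrite dE => h.
have := le_trans (ler_norm _) h; rewrite expr2 -mulrA ler_pM2l //.
Qed.

End MeanValue.

(** * Lipschitz estimates *)

Section LipschitzExtension.
Variable R : realType.
Implicit Types (z x y : cplx R) (D : set (cplx R)).

(* McShane's formula U x = inf_{y in D} (u y + L |x - y|). *)
Lemma mcshane_extension (u : cplx R -> R) D (L : R) : 0 <= L -> D !=set0 ->
  (forall x y, D x -> D y -> u x - u y <= L * cabs (x - y)) ->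
  exists U : cplx R -> R, (forall x, D x -> U x = u x) /\
    forall x y, `|U x - U y| <= L * cabs (x - y).
Proof.
move=> L0 [y0 Dy0] uL.
pose E x := [set u y + L * cabs (x - y) | y in D].
have E0 x : E x !=set0 by exists (u y0 + L * cabs (x - y0)), y0.
have Elb x : has_lbound (E x).
  exists (u y0 - L * cabs (x - y0)) => _ [y Dy <-].
  rewrite lerBlDr -addrA -lerBlDl; apply: le_trans (uL _ _ Dy0 Dy) _.
  rewrite -mulrDr; apply: ler_wpM2l => //.
  by rewrite [leRHS]addrC [cabs (x - y0)]cabsB; exact: cabs_triangle.
exists (fun x => inf (E x)); split.
  move=> x Dx; apply/le_anti/andP; split.
    by apply: ge_inf => //; exists x => //; rewrite subrr cabs0 mulr0 addr0.
  apply: lb_le_inf => // _ [y Dy <-]; rewrite -lerBlDl; exact: uL.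
have half x y : inf (E x) - inf (E y) <= L * cabs (x - y).
  rewrite lerBlDr -lerBlDl; apply: lb_le_inf => // _ [v Dv <-].
  rewrite lerBlDl; apply: (@le_trans _ _ (u v + L * cabs (x - v))).
    by apply: ge_inf => //; exists v.
  by rewrite addrCA lerD2l -mulrDr; apply: ler_wpM2l => //; exact: cabs_triangle.
by move=> x y; rewrite ler_norml half lerNl opprB cabsB half.
Qed.

(** Real and imaginary parts are extended separately, which costs a factor 2. The loss affects only
    continuity arguments: [lipschitz_closed_disk] recovers the sharp constant on the closed disk. *)
Lemma lipschitz_extension (f : cplx R -> cplx R) D (L : R) : 0 <= L -> D !=set0 ->
  (forall x y, D x -> D y -> cabs (f x - f y) <= L * cabs (x - y)) ->
  exists F : cplx R -> cplx R, (forall x, D x -> F x = f x) /\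
    forall x y, cabs (F x - F y) <= 2 * L * cabs (x - y).
Proof.
move=> L0 D0 fL.
have [|U [Uf UL]] := @mcshane_extension (fun x => complex.Re (f x)) D L L0 D0.
- by move=> x y Dx Dy; rewrite -ReB; apply: le_trans (ler_norm _) _;
    apply: le_trans (Re_le_cabs _) (fL _ _ Dx Dy).
have [|V [Vf VL]] := @mcshane_extension (fun x => complex.Im (f x)) D L L0 D0.
- by move=> x y Dx Dy; rewrite -ImB; apply: le_trans (ler_norm _) _;
    apply: le_trans (Im_le_cabs _) (fL _ _ Dx Dy).
exists (fun x => U x +i* V x); split.
  by move=> x Dx; rewrite Uf // Vf //; case: (f x).
move=> x y; apply: le_trans (cabs_le_ReIm _) _.
by rewrite ReB ImB /= mulr2n mulrDl mul1r mulrDl; apply: lerD.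
Qed.

Lemma lipschitz_continuous_cplx (f : cplx R -> cplx R) (L : R) : 0 <= L ->
  (forall x y, cabs (f x - f y) <= L * cabs (x - y)) -> continuous f.
Proof.
move=> L0 fL x; apply/continuous_cplx => e e0.
have L1 : 0 < L + 1 by rewrite ltr_wpDl.
exists (e / (L + 1)); first by rewrite divr_gt0.
move=> y; rewrite ltr_pdivlMr // => yx; apply: le_lt_trans (fL _ _) _.
apply: le_lt_trans yx; rewrite mulrC; apply: ler_wpM2l; first exact: cabs_ge0.
by rewrite lerDl.
Qed.

(** Shrink both points towards 0, apply the sharp constant L inside the disk, and pay for the
    shrinking with the crude constant C; the payment is arbitrarily small. *)
Lemma lipschitz_closed_disk (f : cplx R -> cplx R) (L C : R) : 0 <= L -> 0 <= C ->
  (forall x y, cabs (f x - f y) <= C * cabs (x - y)) ->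
  (forall x y, cabs x < 1 -> cabs y < 1 -> cabs (f x - f y) <= L * cabs (x - y)) ->
  forall x y, cabs x <= 1 -> cabs y <= 1 -> cabs (f x - f y) <= L * cabs (x - y).
Proof.
move=> L0 C0 fC fL x y x1 y1; apply/ler_addgt0Pr => e e0.
have C1 : 0 < 2 * C + 1 by rewrite ltr_wpDl // mulr_ge0.
(* The two shifts cost at most 2 C s <= e, and s <= 1 keeps the factor t nonnegative. *)
pose s := Num.min (e / (2 * C + 1)) 1; pose t := 1 - s.
have s0 : 0 < s by rewrite lt_min divr_gt0 //=.
have s1 : s <= 1 by rewrite ge_min lexx orbT.
have t0 : 0 <= t by rewrite subr_ge0.
have t1 : t < 1 by rewrite /t ltrBlDr ltrDl.
have ct z : cabs (t%:C * z) = t * cabs z by rewrite cabsM cabs_real ger0_norm.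
have small z : cabs z <= 1 -> cabs (t%:C * z) < 1.
  by move=> z1; rewrite ct; apply: le_lt_trans t1; rewrite ler_piMr.
have near z : cabs z <= 1 -> cabs (f z - f (t%:C * z)) <= C * s.
  move=> z1; apply: le_trans (fC _ _) _; apply: ler_wpM2l => //.
  have -> : z - t%:C * z = s%:C * z by rewrite /t rmorphB rmorph1; ring.
  by rewrite cabsM cabs_real gtr0_norm // ler_piMr // ltW.
have -> : f x - f y = (f (t%:C * x) - f (t%:C * y)) +
  ((f x - f (t%:C * x)) - (f y - f (t%:C * y))) by ring.
apply: le_trans (cabsD _ _) _; apply: lerD.
  apply: le_trans (fL _ _ (small _ x1) (small _ y1)) _; apply: ler_wpM2l => //.
  by rewrite -mulrBr ct ler_piMl ?cabs_ge0 // ltW.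
apply: le_trans (cabsD _ _) _; rewrite cabsN.
apply: le_trans (lerD (near _ x1) (near _ y1)) _.
have : s * (2 * C + 1) <= e by rewrite -ler_pdivlMr // ge_min lexx.
apply: le_trans; rewrite -subr_ge0.
have -> : s * (2 * C + 1) - (C * s + C * s) = s by ring.
exact: ltW.
Qed.

Lemma lipschitz_across_circle (f : cplx R -> cplx R) (K : R) : 0 <= K ->
  (forall x y, cabs x <= 1 -> cabs y <= 1 -> cabs (f x - f y) <= K * cabs (x - y)) ->
  (forall x y, 1 <= cabs x -> 1 <= cabs y -> cabs (f x - f y) <= K * cabs (x - y)) ->
  forall x y, cabs (f x - f y) <= K * cabs (x - y).
Proof.
move=> K0 fin fout.
have cross x y : cabs x <= 1 -> 1 <= cabs y -> cabs (f x - f y) <= K * cabs (x - y).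
  move=> x1 y1; pose g (t : R) := cabs (x + t%:C * (y - x)).
  have g0 : g 0 = cabs x by rewrite /g rmorph0 mul0r addr0.
  have g1 : g 1 = cabs y by rewrite /g rmorph1 mul1r addrC subrK.
  have gc : {within `[0, 1], continuous g}.
    apply: continuous_subspaceT => t; apply/cvgrPdist_lt => e e0.
    have L1 : 0 < cabs (y - x) + 1 by rewrite ltr_wpDl ?cabs_ge0.
    apply/nbhs_ballP; exists (e / (cabs (y - x) + 1)); first by rewrite /= divr_gt0.
    move=> s; rewrite /ball /= ltr_pdivlMr // => ts.
    apply: le_lt_trans (cabs_dist _ _) _.
    have -> : x + t%:C * (y - x) - (x + s%:C * (y - x)) = (t - s)%:C * (y - x).
      by rewrite rmorphB; ring.
    rewrite cabsM cabs_real; apply: le_lt_trans ts.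
    by apply: ler_wpM2l => //; rewrite lerDl.
  have [|c] := @IVT R g 0 1 1 ler01 gc.
    by rewrite g0 g1 ge_min le_max x1 y1 orbT.
  rewrite in_itv /= => /andP[c0 c1] gc1.
  pose m := x + c%:C * (y - x); have m1 : cabs m = 1 by [].
  have -> : f x - f y = (f x - f m) + (f m - f y) by ring.
  apply: le_trans (cabsD _ _) _.
  apply: le_trans (lerD (fin _ _ x1 _) (fout _ _ _ y1)) _; rewrite ?m1 //.
  rewrite -mulrDr; apply: ler_wpM2l => //.
  have -> : x - m = c%:C * (x - y) by rewrite /m; ring.
  have -> : m - y = (1 - c)%:C * (x - y) by rewrite /m rmorphB rmorph1; ring.
  rewrite !cabsM !cabs_real !ger0_norm ?subr_ge0 // -mulrDl.
  by rewrite addrC subrK mul1r.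
move=> x y; case: (lerP (cabs x) 1) => x1; case: (lerP (cabs y) 1) => y1.
- exact: fin.
- by apply: cross => //; exact: ltW.
- by rewrite cabsB [cabs (x - y)]cabsB; apply: cross => //; exact: ltW.
- by apply: fout; exact: ltW.
Qed.

End LipschitzExtension.

Section RealDiffProduct.
Variable R : realType.

Lemma real_diff_mul (F G : cplx R -> cplx R) (z a b c d : cplx R) :
  real_diff F z a b -> real_diff G z c d ->
  real_diff (fun w => F w * G w) z (F z * c + G z * a) (F z * d + G z * b).
Proof.
move=> Fd Gd e e0.
have [C [d1 [C0 d10 FC]]] := real_diff_bounded Fd.
have [K [d2 [K0 d20 GK]]] := real_diff_bounded Gd.
have F1 : 0 < cabs (F z) + 1 by rewrite ltr_wpDl ?cabs_ge0.
have G1 : 0 < cabs (G z) + 1 by rewrite ltr_wpDl ?cabs_ge0.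
have e3 : 0 < e / 3 by rewrite divr_gt0.
have [d3 d30 dF] := Fd _ (divr_gt0 e3 G1).
have [d4 d40 dG] := Gd _ (divr_gt0 e3 F1).
exists (Num.min (Num.min d1 d2) (Num.min (Num.min d3 d4) (e / 3 / (C * K)))).
  by rewrite !lt_min d10 d20 d30 d40 divr_gt0 // mulr_gt0.
move=> u; rewrite !lt_min => /andP[/andP[/FC uF /GK uG] /andP[/andP[/dF hF /dG hG]]].
rewrite ltr_pdivlMr ?mulr_gt0 // => ue.
pose f := F (z + u) - F z; pose g := G (z + u) - G z.
(* Each of the three summands receives e/3; the last, a product of two increments, is at most C K
   |u|^2. *)
have -> : F (z + u) * G (z + u) - F z * G z -
   ((F z * c + G z * a) * u + (F z * d + G z * b) * conjc u)
  = G z * (f - (a * u + b * conjc u)) + F z * (g - (c * u + d * conjc u)) + f * g.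
  by rewrite /f /g; ring.
have third x y : 0 <= x -> y <= e / 3 / (x + 1) * cabs u -> x * y <= e / 3 * cabs u.
  move=> x0 yx; have x1 : 0 < x + 1 by rewrite ltr_wpDl.
  apply: le_trans (ler_wpM2l x0 yx) _.
  have -> : x * (e / 3 / (x + 1) * cabs u) = e / 3 * cabs u * (x / (x + 1)) by ring.
  rewrite -[leRHS]mulr1; apply: ler_wpM2l; first by rewrite mulr_ge0 ?cabs_ge0 // ltW.
  by rewrite ler_pdivrMr // mul1r lerDl.
have -> : e * cabs u = e / 3 * cabs u + e / 3 * cabs u + e / 3 * cabs u by field.
apply: le_trans (cabsD _ _) _; apply: lerD.
  apply: le_trans (cabsD _ _) _; rewrite !cabsM.
  by apply: lerD; apply: third; rewrite ?cabs_ge0.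
rewrite cabsM; apply: (@le_trans _ _ ((C * cabs u) * (K * cabs u))).
  by apply: ler_pM; rewrite ?cabs_ge0.
have -> : C * cabs u * (K * cabs u) = cabs u * (C * K) * cabs u by ring.
by apply: ler_wpM2r; [exact: cabs_ge0|exact: ltW].
Qed.

End RealDiffProduct.

(** * Folding the plane onto the closed disk *)

Definition disk_auto (R : realType) (p : R) (o : cplx R) : cplx R :=
  (o + p%:C) / (1 + p%:C * o).

(** The inverse of z |-> o = (1 - p z)/(z - p). Its reciprocal [disk_auto] therefore equals 1/z, and
    is a Moebius automorphism of the unit disk. *)
Definition exterior_auto (R : realType) (p : R) (o : cplx R) : cplx R :=
  (1 + p%:C * o) / (o + p%:C).

(* With o = (1 - p z) / (z - p), this is 1 / conj z if |z| >= 1 and z if |z| < 1. *)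
Definition fold_disk (R : realType) (p : R) (o : cplx R) : cplx R :=
  if cabs o <= 1 then conjc (disk_auto p o) else exterior_auto p o.

Section Fold.
Variables (R : realType) (p : R).
Hypothesis p01 : 0 <= p < 1.
Implicit Types (o x y : cplx R).

Let p0 : 0 <= p. Proof. by case/andP: p01. Qed.
Let p1 : 0 < 1 - p. Proof. by case/andP: p01; rewrite subr_gt0. Qed.
Let pp1 : 0 < 1 - p ^+ 2.
Proof. by rewrite subr_gt0 expr_lt1 //; case/andP: p01. Qed.

Lemma disk_auto_den o : cabs o <= 1 -> 1 - p <= cabs (1 + p%:C * o).
Proof.
move=> o1; have := cabs_sub 1 (- (p%:C * o)).
rewrite cabs1 cabsN opprK; apply: le_trans.
by rewrite lerD2l lerN2 cabsM cabs_real ger0_norm // ler_piMr.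
Qed.

Lemma exterior_auto_den o : 1 <= cabs o -> 1 - p <= cabs (o + p%:C).
Proof.
move=> o1; have := cabs_sub o (- p%:C).
by rewrite cabsN opprK cabs_real ger0_norm //; apply: le_trans; rewrite lerD2r.
Qed.

(** The sign of this difference decides which of numerator and denominator is larger, hence on which
    side of the unit circle both maps take their values. *)
Lemma cabs_auto o : cabs (1 + p%:C * o) ^+ 2 - cabs (o + p%:C) ^+ 2 =
  (1 - p ^+ 2) * (1 - cabs o ^+ 2).
Proof. by rewrite !sqr_cabs; case: o => u v /=; ring. Qed.

Lemma disk_auto_le1 o : cabs o <= 1 -> cabs (disk_auto p o) <= 1.
Proof.
move=> o1; have d0 := lt_le_trans p1 (disk_auto_den o1).
rewrite /disk_auto cabsM cabsV ler_pdivrMr // mul1r.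
rewrite -ler_sqr ?nnegrE ?cabs_ge0 // -subr_ge0 cabs_auto mulr_ge0 ?(ltW pp1) //.
by rewrite subr_ge0 expr_le1 ?cabs_ge0.
Qed.

Lemma exterior_auto_lt1 o : 1 < cabs o -> cabs (exterior_auto p o) < 1.
Proof.
move=> o1; have d0 := lt_le_trans p1 (exterior_auto_den (ltW o1)).
rewrite /exterior_auto cabsM cabsV ltr_pdivrMr // mul1r.
rewrite -ltr_sqr ?nnegrE ?cabs_ge0 // -subr_lt0 cabs_auto pmulr_rlt0 //.
by rewrite subr_lt0 expr_gt1 ?cabs_ge0.
Qed.

(** On the circle conj o = 1/o, so the two branches of the fold agree there. *)
Lemma conj_disk_auto o : cabs o = 1 -> conjc (disk_auto p o) = exterior_auto p o :> cplx R.
Proof.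
move=> o1; have oo : o * conjc o = 1 by rewrite mul_conj o1 expr1n.
have o0 : o != 0 by rewrite -cabs_gt0 o1.
have d0 : 1 + p%:C * o != 0 by rewrite -cabs_gt0 (lt_le_trans p1) // disk_auto_den ?o1.
have d1 : o + p%:C != 0 by rewrite -cabs_gt0 (lt_le_trans p1) // exterior_auto_den ?o1.
rewrite /disk_auto /exterior_auto conjM conjV !conjD conjM conj_real conj1.
have -> : conjc o = o^-1 :> cplx R by apply: (mulfI o0); rewrite oo divff.
by field; rewrite o0 andbT; exact: d1.
Qed.

(** The difference of two values is (1 - p^2)(x - y) over the product of the two denominators, each
    at least 1 - p in modulus. The same computation settles the exterior branch. *)
Lemma disk_auto_lipschitz x y : cabs x <= 1 -> cabs y <= 1 ->
  cabs (disk_auto p x - disk_auto p y) <=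
  (1 - p ^+ 2) / (1 - p) ^+ 2 * cabs (x - y).
Proof.
move=> x1 y1; have dx := disk_auto_den x1; have dy := disk_auto_den y1.
have dx0 : 1 + p%:C * x != 0 by rewrite -cabs_gt0 (lt_le_trans p1).
have dy0 : 1 + p%:C * y != 0 by rewrite -cabs_gt0 (lt_le_trans p1).
have -> : disk_auto p x - disk_auto p y =
    (1 - p ^+ 2)%:C * (x - y) / ((1 + p%:C * x) * (1 + p%:C * y)).
  by rewrite /disk_auto rmorphB rmorph1 rmorphXn; field; rewrite dx0 dy0.
rewrite !cabsM cabsV cabsM cabs_real (gtr0_norm pp1) mulrAC.
apply: ler_wpM2r; first exact: cabs_ge0.
apply: ler_wpM2l; first exact: ltW.
rewrite lef_pV2 ?posrE ?exprn_gt0 ?mulr_gt0 ?cabs_gt0 //.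
by rewrite expr2; apply: ler_pM => //; exact: ltW.
Qed.

Lemma exterior_auto_lipschitz x y : 1 <= cabs x -> 1 <= cabs y ->
  cabs (exterior_auto p x - exterior_auto p y) <=
  (1 - p ^+ 2) / (1 - p) ^+ 2 * cabs (x - y).
Proof.
move=> x1 y1; have dx := exterior_auto_den x1; have dy := exterior_auto_den y1.
have dx0 : x + p%:C != 0 by rewrite -cabs_gt0 (lt_le_trans p1).
have dy0 : y + p%:C != 0 by rewrite -cabs_gt0 (lt_le_trans p1).
have -> : exterior_auto p x - exterior_auto p y =
    - ((1 - p ^+ 2)%:C * (x - y)) / ((x + p%:C) * (y + p%:C)).
  by rewrite /exterior_auto rmorphB rmorph1 rmorphXn; field; rewrite dx0 dy0.
rewrite cabsM cabsN !cabsM cabsV cabsM cabs_real (gtr0_norm pp1) mulrAC.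
apply: ler_wpM2r; first exact: cabs_ge0.
apply: ler_wpM2l; first exact: ltW.
rewrite lef_pV2 ?posrE ?exprn_gt0 ?mulr_gt0 ?cabs_gt0 //.
by rewrite expr2; apply: ler_pM => //; exact: ltW.
Qed.

Lemma fold_disk_out o : 1 <= cabs o -> fold_disk p o = exterior_auto p o.
Proof.
rewrite /fold_disk le_eqVlt => /orP[/eqP o1|o1]; last by rewrite leNgt o1.
by rewrite -o1 lexx conj_disk_auto.
Qed.

Lemma cabs_fold_disk o : cabs (fold_disk p o) <= 1.
Proof.
rewrite /fold_disk; case: (lerP (cabs o) 1) => o1.
  by rewrite cabs_conj disk_auto_le1.
exact/ltW/exterior_auto_lt1.
Qed.

Lemma ln_lipschitz (x y : R) : 1 <= x -> 1 <= y -> `|ln x - ln y| <= `|x - y|.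
Proof.
have half (s t : R) : 1 <= s -> 1 <= t -> s <= t -> ln t - ln s <= t - s.
  move=> s1 t1 st; have s0 : 0 < s by exact: lt_le_trans s1.
  have t0 : 0 < t by exact: lt_le_trans t1.
  have d0 : 0 <= (t - s) / s by rewrite divr_ge0 ?subr_ge0 // ltW.
  have -> : ln t - ln s = ln (1 + (t - s) / s).
    rewrite -ln_div ?posrE //; congr ln; field; exact: lt0r_neq0.
  apply: (@le_trans _ _ ((t - s) / s)); first by apply: le_ln1Dx; lra.
  by rewrite ler_pdivrMr // ler_peMr // subr_ge0.
move=> x1 y1; case: (lerP x y) => xy.
  have xy' : ln x <= ln y by rewrite ler_ln ?posrE // (lt_le_trans ltr01).
  by rewrite distrC ger0_norm ?subr_ge0 //; apply: half.
have xy' : ln y <= ln x by rewrite ler_ln ?posrE ?(ltW xy) // (lt_le_trans ltr01).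
by rewrite ger0_norm ?subr_ge0 //; apply: half => //; exact: ltW.
Qed.

(* The perturbation of 1/(z - p) in the variable o = (1 - p z) / (z - p). *)
Definition folded_map (A : cplx R) (H : cplx R -> cplx R) o : cplx R :=
  H (fold_disk p o) + A * (ln (Num.max 1 (cabs o)))%:C.

Lemma folded_map_lipschitz A H (L : R) : 0 <= L ->
  (forall x y, cabs x <= 1 -> cabs y <= 1 -> cabs (H x - H y) <= L * cabs (x - y)) ->
  forall x y, cabs (folded_map A H x - folded_map A H y) <=
    (L * ((1 - p ^+ 2) / (1 - p) ^+ 2) + cabs A) * cabs (x - y).
Proof.
move=> L0 HL; set M := (1 - p ^+ 2) / _.
have M0 : 0 <= M by rewrite divr_ge0 ?sqr_ge0 // ltW.
apply: lipschitz_across_circle => [|x y x1 y1|x y x1 y1].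
- by apply: addr_ge0; [exact: mulr_ge0 | exact: cabs_ge0].
- rewrite /folded_map /fold_disk x1 y1 !max_l // ln1 rmorph0 mulr0 !addr0.
  apply: le_trans (HL _ _ _ _) _; rewrite ?cabs_conj ?disk_auto_le1 //.
  rewrite -conjB cabs_conj mulrDl -[leLHS]addr0; apply: lerD.
    by rewrite -mulrA; apply: ler_wpM2l => //; exact: disk_auto_lipschitz.
  by rewrite mulr_ge0 ?cabs_ge0.
- rewrite /folded_map !max_r //.
  have -> : H (fold_disk p x) + A * (ln (cabs x))%:C - (H (fold_disk p y) + A * (ln (cabs y))%:C)
    = (H (fold_disk p x) - H (fold_disk p y)) + A * (ln (cabs x) - ln (cabs y))%:C.
    by rewrite rmorphB; ring.
  apply: le_trans (cabsD _ _) _; rewrite mulrDl; apply: lerD.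
    apply: le_trans (HL _ _ (cabs_fold_disk _) (cabs_fold_disk _)) _.
    rewrite !fold_disk_out // -mulrA; apply: ler_wpM2l => //.
    exact: exterior_auto_lipschitz.
  rewrite cabsM cabs_real; apply: ler_wpM2l; first exact: cabs_ge0.
  exact: le_trans (ln_lipschitz x1 y1) (cabs_dist _ _).
Qed.

End Fold.

Section FoldedDifferential.
Variables (R : realType) (p : R).
Hypothesis p01 : 0 <= p < 1.
Implicit Types (o x y z : cplx R).

Let p0 : 0 <= p. Proof. by case/andP: p01. Qed.
Let p1 : 0 < 1 - p. Proof. by case/andP: p01; rewrite subr_gt0. Qed.
Let pp1 : 0 < 1 - p ^+ 2.
Proof. by rewrite subr_gt0 expr_lt1 //; case/andP: p01. Qed.

Lemma real_diff_ratio (F G : cplx R -> cplx R) z (a b c d : cplx R) :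
  real_diff F z a b -> real_diff G z c d -> G z != 0 ->
  exists a' b', real_diff (fun w => F w / G w) z a' b'.
Proof.
move=> Fd Gd Gz; do 2 eexists; apply: real_diff_mul; first exact: Fd.
exact: real_diff_comp Gd (real_diff_inv Gz).
Qed.

(** The values of the derivatives are left open: their size will come from the Lipschitz constant
    through [real_diff_lipschitz]. *)
Lemma folded_map_real_diff A (H : cplx R -> cplx R) o :
  (forall z, cabs z < 1 -> exists a b, real_diff H z a b) -> cabs o != 1 ->
  exists a b, real_diff (folded_map p A H) o a b.
Proof.
move=> Hd; have num : real_diff (fun w : cplx R => 1 + p%:C * w) o (0 + p%:C * 1) (0 + p%:C * 0).
  exact: real_diffD (real_diff_cst _ _) (real_diffM _ (real_diff_id _)).
have den : real_diff (fun w : cplx R => w + p%:C) o (1 + 0) (0 + 0).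
  exact: real_diffD (real_diff_id _) (real_diff_cst _ _).
rewrite neq_lt => /orP[ o1 | o1 ].
  have oz : 1 + p%:C * o != 0.
    by rewrite -cabs_gt0 (lt_le_trans p1) // (disk_auto_den p01 (ltW o1)).
  have [a [b /real_diff_conj ab]] := real_diff_ratio den num oz.
  have d1 : cabs (conjc (disk_auto p o)) < 1.
    rewrite cabs_conj /disk_auto cabsM cabsV ltr_pdivrMr ?cabs_gt0 // mul1r.
    rewrite -ltr_sqr ?nnegrE ?cabs_ge0 // -subr_gt0 cabs_auto pmulr_rgt0 //.
    by rewrite subr_gt0 expr_lt1 ?cabs_ge0.
  have [c [d cd]] := Hd _ d1.
  have rd := real_diff_comp ab cd.
  (* Closer to o than 1 - |o| the same branch of the fold applies and the logarithmic term is 0. *)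
  do 2 eexists; apply: real_diff_near (_ : 0 < 1 - cabs o) _ rd; first by rewrite subr_gt0.
  move=> u ou; have ou1 : cabs (o + u) <= 1.
    by apply: le_trans (cabsD _ _) _; rewrite addrC -lerBrDr ltW.
  by rewrite /folded_map /fold_disk ou1 max_l // ln1 rmorph0 mulr0 addr0.
have oz : o + p%:C != 0.
  by rewrite -cabs_gt0 (lt_le_trans p1) // (exterior_auto_den p01 (ltW o1)).
have [a [b ab]] := real_diff_ratio num den oz.
have [c [d cd]] := Hd _ (exterior_auto_lt1 p01 o1).
have o0 : o != 0 by rewrite -cabs_gt0 (lt_trans ltr01).
have rd := real_diffD (real_diff_comp ab cd) (real_diffM A (real_diff_ln_cabs o0)).
do 2 eexists; apply: real_diff_near (_ : 0 < cabs o - 1) _ rd; first by rewrite subr_gt0.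
move=> u ou; have ou1 : 1 <= cabs (o + u).
  have := cabs_sub o (- u); rewrite cabsN opprK; apply: le_trans.
  by rewrite lerBrDr addrC -lerBrDr ltW.
by rewrite /folded_map fold_disk_out // max_r.
Qed.

End FoldedDifferential.

(** * The extension as a perturbed identity in the variable 1/(z - p) *)

Section ExtensionFormula.
Variables (R : realType) (k p : R) (A : cplx R) (a b : nat -> cplx R).
Variables (h g : cplx R -> cplx R) (f : cplx R -> sphere R).
Hypothesis p01 : 0 <= p < 1.
Hypothesis f_form : has_form p A a b h g f.
Hypothesis f_bound : forall z : cplx R, disk z ->
  `|derive1 h z| + `|derive1 g z| <=
  (k / (1 + p) ^+ 2)%:C - ((p ^+ 2 + 1) / (1 - p ^+ 2))%:C * `|A|.

Let p0 : 0 <= p. Proof. by case/andP: p01. Qed.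
Let p1 : 0 < 1 - p. Proof. by case/andP: p01; rewrite subr_gt0. Qed.
Let pp1 : 0 < 1 - p ^+ 2.
Proof. by rewrite subr_gt0 expr_lt1 //; case/andP: p01. Qed.

Let L := k / (1 + p) ^+ 2 - (p ^+ 2 + 1) / (1 - p ^+ 2) * cabs A.

(** Both sides of the hypothesis are real elements of [cplx R], so the inequality descends to R. *)
Let derive_le z : disk z -> cabs (derive1 h z) + cabs (derive1 g z) <= L.
Proof.
move=> zd.
have : (cabs (derive1 h z))%:C + (cabs (derive1 g z))%:C <=
  (k / (1 + p) ^+ 2)%:C - ((p ^+ 2 + 1) / (1 - p ^+ 2))%:C * (cabs A)%:C :> cplx R.
  exact: (f_bound zd).
by rewrite -realBM -realD lecR.
Qed.

Let disk_segment (z0 z1 : cplx R) (t : R) : cabs z0 < 1 -> cabs z1 < 1 ->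
  0 <= t <= 1 -> disk (z0 + t%:C * (z1 - z0)).
Proof.
move=> h0 h1 /andP[t0 t1]; rewrite diskE.
have -> : z0 + t%:C * (z1 - z0) = (1 - t)%:C * z0 + t%:C * z1.
  by rewrite rmorphB rmorph1; ring.
apply: le_lt_trans (cabsD _ _) _; rewrite !cabsM !cabs_real !ger0_norm ?subr_ge0 //.
have m0 : Num.max (cabs z0) (cabs z1) < 1 by rewrite gt_max h0.
apply: le_lt_trans m0; set m := Num.max _ _.
have -> : m = (1 - t) * m + t * m by ring.
by apply: lerD; apply: ler_wpM2l; rewrite ?subr_ge0 // /m le_max lexx ?orbT.
Qed.

Let L0 : 0 <= L.
Proof.
have /derive_le : disk (0 : cplx R) by rewrite diskE cabs0.
by apply: le_trans; rewrite addr_ge0 ?cabs_ge0.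
Qed.

Let hd z : disk z -> real_diff h z (derive1 h z) 0.
Proof. by case: f_form => ah _ _ _; exact: real_diff_power_series ah. Qed.

Let gd z : disk z -> real_diff (fun w => conjc (g w)) z 0 (conjc (derive1 g z)).
Proof.
case: f_form => _ bg _ _ zd; have := real_diff_conj (real_diff_power_series bg zd).
by rewrite (_ : conjc 0 = 0 :> cplx R) //; exact: (rmorph0 (@conjc R)).
Qed.

Let hgd z : disk z ->
  real_diff (fun w => h w + conjc (g w)) z (derive1 h z) (conjc (derive1 g z)).
Proof.
by move=> zd; have := real_diffD (hd zd) (gd zd); rewrite addr0 add0r.
Qed.

Let disk_lipschitz (F : cplx R -> cplx R) :
  (forall z, disk z -> exists a b, real_diff F z a b /\ cabs a + cabs b <= L) ->
  forall x y : cplx R, cabs x < 1 -> cabs y < 1 -> cabs (F x - F y) <= L * cabs (x - y).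
Proof.
move=> Fd x y x1 y1; apply: real_diff_mean_value => t t01.
exact/Fd/disk_segment.
Qed.

(** h and g are Lipschitz separately, which gives their continuous extensions. The sum h + conj g is
    estimated on its own: its derivatives satisfy |h'| + |g'| <= L, so it has constant L and not 2
    L. *)
Lemma lipschitz_boundary_extension : exists hbar gbar : cplx R -> cplx R,
  [/\ continuous_extension h hbar, continuous_extension g gbar,
    forall z, disk z -> exists a b,
      real_diff (fun w => hbar w + conjc (gbar w)) z a b
  & forall x y : cplx R, cabs x <= 1 -> cabs y <= 1 ->
    cabs ((hbar x + conjc (gbar x)) - (hbar y + conjc (gbar y))) <= L * cabs (x - y)].
Proof.
have D0 : @disk R !=set0 by exists 0; rewrite diskE cabs0.
have hL (x y : cplx R) : disk x -> disk y -> cabs (h x - h y) <= L * cabs (x - y).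
  rewrite !diskE; apply: disk_lipschitz => z zd; exists (derive1 h z), 0; split; first exact: hd.
  by rewrite cabs0 addr0; apply: le_trans (derive_le zd); rewrite lerDl cabs_ge0.
have gL (x y : cplx R) : disk x -> disk y -> cabs (g x - g y) <= L * cabs (x - y).
  move=> xd yd; rewrite -cabs_conj conjB; move: xd yd.
  rewrite !diskE; apply: (disk_lipschitz (F := fun w => conjc (g w))) => z zd.
  exists 0, (conjc (derive1 g z)); split; first exact: gd.
  by rewrite cabs0 add0r cabs_conj; apply: le_trans (derive_le zd); rewrite lerDr cabs_ge0.
have [hbar [hE hbL]] := lipschitz_extension L0 D0 hL.
have [gbar [gE gbL]] := lipschitz_extension L0 D0 gL.
have L2 : 0 <= 2 * L by rewrite mulr_ge0.
exists hbar, gbar; split.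
- by split=> //; apply: continuous_subspaceT; exact: lipschitz_continuous_cplx L2 hbL.
- by split=> //; apply: continuous_subspaceT; exact: lipschitz_continuous_cplx L2 gbL.
- move=> z zd; have zd' := zd; rewrite diskE in zd'.
  exists (derive1 h z), (conjc (derive1 g z)).
  apply: real_diff_near (_ : 0 < 1 - cabs z) _ (hgd zd); first by rewrite subr_gt0.
  move=> u uz; have zu : disk (z + u).
    by rewrite diskE; apply: le_lt_trans (cabsD _ _) _; rewrite addrC -ltrBrDr.
  by rewrite hE // gE.
pose H (w : cplx R) := hbar w + conjc (gbar w).
(* The constant 2 L + 2 L is the crude one on the whole plane, coming from the separate extensions
   of h and g. *)
apply: (@lipschitz_closed_disk _ H L (2 * L + 2 * L)) => //; first exact: addr_ge0.
  move=> x y; rewrite /H.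
  have -> : hbar x + conjc (gbar x) - (hbar y + conjc (gbar y)) =
    (hbar x - hbar y) + conjc (gbar x - gbar y) by rewrite conjB; ring.
  by apply: le_trans (cabsD _ _) _; rewrite mulrDl cabs_conj; apply: lerD.
move=> x y x1 y1; rewrite /H !hE ?gE ?diskE //.
apply: (disk_lipschitz (F := fun w => h w + conjc (g w))) => // z zd.
exists (derive1 h z), (conjc (derive1 g z)); split; first exact: hgd.
by rewrite cabs_conj derive_le.
Qed.

(** Packages [F_ext] as inversion at p followed by w + psi w. The topological and analytic sections
    below see only an abstract map of this form. *)
Lemma F_ext_perturbed_identity : exists hbar gbar psi : cplx R -> cplx R,
  [/\ continuous_extension h hbar, continuous_extension g gbar,
    forall x y : cplx R, cabs (psi x - psi y) <= k * cabs (x - y),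
    forall z : cplx R, z != p%:C -> cabs z != 1 ->
      exists a b, real_diff psi (1 / (z - p%:C)) a b
  & [/\ forall z : cplx R, z != p%:C -> F_ext p f hbar gbar (fin z) =
          fin (1 / (z - p%:C) + psi (1 / (z - p%:C))),
      F_ext p f hbar gbar (fin (p%:C : cplx R)) = infty
    & F_ext p f hbar gbar infty = fin (psi 0)]].
Proof.
have [hbar [gbar [hc gc Hd HL]]] := lipschitz_boundary_extension.
pose H (w : cplx R) := hbar w + conjc (gbar w).
pose om (w : cplx R) : cplx R := (1 - p ^+ 2)%:C * w - p%:C.
pose psi w := folded_map p A H (om w).
have omE (z : cplx R) : z != p%:C -> om (1 / (z - p%:C)) = (1 - p%:C * z) / (z - p%:C).
  rewrite -subr_eq0 => zp; rewrite /om rmorphB rmorph1 rmorphXn; field; exact: zp.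
have num_den (z : cplx R) : cabs (1 - p%:C * z) ^+ 2 - cabs (z - p%:C) ^+ 2 =
  (1 - p ^+ 2) * (1 - cabs z ^+ 2).
  by rewrite !sqr_cabs; case: z => u v /=; ring.
have om_gt1 (z : cplx R) : z != p%:C -> (1 < cabs (om (1 / (z - p%:C)))) = (cabs z < 1).
  move=> zp; rewrite omE // cabsM cabsV ltr_pdivlMr ?cabs_gt0 ?subr_eq0 // mul1r.
  rewrite -ltr_sqr ?nnegrE ?cabs_ge0 // -subr_gt0 num_den pmulr_rgt0 // subr_gt0.
  by rewrite expr_lt1 ?cabs_ge0.
have om_eq1 (z : cplx R) : z != p%:C -> (cabs (om (1 / (z - p%:C))) == 1) = (cabs z == 1).
  move=> zp; have dz : cabs (z - p%:C) != 0 by rewrite cabs_eq0 subr_eq0.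
  rewrite omE // cabsM cabsV -(inj_eq (mulIf dz)) mulfVK // mul1r.
  rewrite -(@eqrXn2 _ 2) ?cabs_ge0 // -subr_eq0 num_den mulf_eq0 gt_eqF //=.
  by rewrite subr_eq0 eq_sym -{1}(expr1n _ 2) eqrXn2 ?cabs_ge0.
exists hbar, gbar, psi; split=> //.
- move=> x y; apply: le_trans (folded_map_lipschitz p01 A L0 HL _ _) _.
  have -> : om x - om y = (1 - p ^+ 2)%:C * (x - y) by rewrite /om; ring.
  rewrite cabsM cabs_real gtr0_norm // mulrA; apply: ler_wpM2r; first exact: cabs_ge0.
  have q0 : 0 < 1 + p by rewrite ltr_pwDl.
  (* Here the coefficient of |A| in the hypothesis is spent: (1 + p^2) - (1 - p)^2 = 2 p, so what
     remains to subtract from k is nonnegative. *)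
  have -> : (L * ((1 - p ^+ 2) / (1 - p) ^+ 2) + cabs A) * (1 - p ^+ 2) =
    k - cabs A * (2 * p * (1 + p)) / (1 - p).
    by rewrite /L; field; rewrite !gt_eqF.
  rewrite gerBl; rewrite !mulr_ge0 ?invr_ge0 ?cabs_ge0 ?(ltW p1) ?(ltW q0) //.
- move=> z zp z1.
  have Hd' : forall z : cplx R, cabs z < 1 -> exists a b, real_diff H z a b.
    by move=> w w1; apply: Hd; rewrite diskE.
  have o1 : cabs (om (1 / (z - p%:C))) != 1 by rewrite om_eq1.
  have [c [d cd]] := folded_map_real_diff p01 A Hd' o1.
  do 2 eexists; apply: real_diff_comp cd.
  exact: real_diffD (real_diffM _ (real_diff_id _)) (real_diff_cst _ _).
case: f_form => _ _ fp fz; case: (hc) => _ hE; case: (gc) => _ gE.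
have pC : 1 - p%:C ^+ 2 != 0 :> cplx R.
  by rewrite -rmorphXn -(rmorph1 (real_complex R)) -rmorphB (fmorph_eq0 (real_complex R)) gt_eqF.
have om_den (z : cplx R) : z != p%:C ->
    om (1 / (z - p%:C)) + p%:C = (1 - p%:C ^+ 2) / (z - p%:C).
  by move=> zp; rewrite omE //; field; rewrite subr_eq0.
have om_num (z : cplx R) : z != p%:C ->
    1 + p%:C * om (1 / (z - p%:C)) = (1 - p%:C ^+ 2) * z / (z - p%:C).
  by move=> zp; rewrite omE //; field; rewrite subr_eq0.
split.
- move=> z zp; have zp0 : z - p%:C != 0 by rewrite subr_eq0.
  (* The test in [F_ext] compares elements of [cplx R]; it becomes the real comparison cabs z <
     1. *)
  rewrite /F_ext /fin normE -[1]/((1 : R)%:C) ltcR rmorph1.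
  case: ifPn => z1.
    have zd : disk z by rewrite diskE.
    rewrite fz // /fin /pole_form; congr Some.
    have o1 := om_gt1 z zp; rewrite z1 in o1.
    rewrite /psi /folded_map fold_disk_out ?(ltW o1) // max_r ?(ltW o1) //.
    have -> : exterior_auto p (om (1 / (z - p%:C))) = z.
      by rewrite /exterior_auto om_den // om_num //; field; rewrite zp0.
    by rewrite /H hE // gE // omE // !addrA.
  have o1 : cabs (om (1 / (z - p%:C))) <= 1 by rewrite leNgt om_gt1.
  have z0 : z != 0 by rewrite -cabs_gt0 (lt_le_trans ltr01) // leNgt.
  rewrite /psi /folded_map /fold_disk o1 max_l // ln1 rmorph0 mulr0 addr0.
  have -> : disk_auto p (om (1 / (z - p%:C))) = z^-1.
    by rewrite /disk_auto om_den // om_num //; field; rewrite z0 zp0.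
  by rewrite /H conjV /fin !div1r addrA.
- by rewrite /F_ext /fin normE cabs_real -[1]/((1 : R)%:C) ltcR ger0_norm // -subr_gt0 p1.
(* The point at infinity is w = 0, that is o = - p, the zero of [disk_auto]; this gives the values
   of the extensions at 0. *)
- have om0 : om 0 = - p%:C by rewrite /om mulr0 add0r.
  have c1 : cabs (- p%:C : cplx R) <= 1.
    by rewrite cabsN cabs_real ger0_norm //; case/andP: p01 => _ /ltW.
  rewrite /psi om0 /folded_map /fold_disk c1 max_l // ln1 rmorph0 mulr0 addr0.
  by rewrite /disk_auto addNr mul0r (rmorph0 (@conjc R)) /F_ext /H add0r.
Qed.

End ExtensionFormula.

(** * Homeomorphisms of the sphere *)

Section SphereTopology.
Variable R : realType.
Implicit Types (z w : cplx R) (P : set (sphere R)).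

Lemma pt_continuous : continuous (@pt R).
Proof.
move=> x P /nbhs_cplx [d d0 dP].
apply/nbhs_ballP; exists (d / 2); first by rewrite /= divr_gt0.
move=> y [/= y1 y2]; apply: dP; apply: le_lt_trans (cabs_le_ReIm _) _.
by rewrite ReB ImB /pt /= [d]splitr distrC [`|y.2 - _|]distrC ltrD.
Qed.

Lemma cabs_continuous : continuous (@cabs R : cplx R -> R).
Proof.
move=> z P /nbhs_ballP [e e0 eP]; apply/nbhs_cplx; exists e => // y yz.
by apply: eP; apply: le_lt_trans (cabs_dist _ _) _; rewrite cabsB.
Qed.

(** The image of a product of segments under [pt]. Complements of such squares will be the basic
    neighbourhoods of infinity. *)
Lemma compact_square (M : R) :
  compact [set z : cplx R | `|complex.Re z| <= M /\ `|complex.Im z| <= M].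
Proof.
have -> : [set z : cplx R | `|complex.Re z| <= M /\ `|complex.Im z| <= M] =
    @pt R @` (`[- M, M] `*` `[- M, M])%classic.
  apply/seteqP; split=> [z [/= zr zi]|_ [[x y] [/= xM yM] <-]].
    exists (complex.Re z, complex.Im z); last by case: (z).
    by split; rewrite /= in_itv /= -ler_norml.
  by move: xM yM; rewrite !in_itv /= -!ler_norml.
apply: continuous_compact.
  by apply: continuous_subspaceT => x; exact: pt_continuous.
by apply: compact_setX; exact: segment_compact.
Qed.

Lemma compact_cabs_bounded (K : set (cplx R)) : compact K ->
  exists M : R, forall z, K z -> cabs z <= M.
Proof.
move=> cK; have : compact (@cabs R @` K).
  apply: continuous_compact => //.
  by apply: continuous_subspaceT => x; exact: cabs_continuous.
move=> /compact_bounded [M [_ /(_ (M + 1))]]; rewrite ltrDl ltr01 => /(_ isT) KM.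
exists (M + 1) => z Kz; apply: le_trans (ler_norm _) _.
by apply: KM; exists z.
Qed.

(** Compact sets of the plane are bounded, and each disk lies in a compact closed square. *)
Lemma nbhs_inftyP P : nbhs (infty : sphere R) P <->
  P infty /\ exists M : R, forall z, M < cabs z -> P (fin z).
Proof.
split=> [[K [cK _] KP]|[Pi [M MP]]].
  split; first by apply: KP; right.
  have [M KM] := compact_cabs_bounded cK; exists M => z Mz.
  by apply: KP; left; exists z => // Kz; have := KM z Kz; rewrite leNgt Mz.
exists [set z : cplx R | `|complex.Re z| <= M /\ `|complex.Im z| <= M].
  split; first exact: compact_square.
  by apply: compact_closed; [exact: norm_hausdorff | exact: compact_square].
move=> _ [[z /= zM <-]| -> //]; apply: MP; rewrite ltNge; apply/negP => Mz.
by apply: zM; split; apply: le_trans Mz; [exact: Re_le_cabs | exact: Im_le_cabs].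
Qed.

Lemma nbhs_finP z P : nbhs (fin z : sphere R) P <->
  exists2 d : R, 0 < d & forall y, cabs (y - z) < d -> P (fin y).
Proof. exact: (nbhs_cplx z (P \o @fin R)). Qed.

Lemma sphere_hausdorff : hausdorff_space (sphere R).
Proof.
have fin_infty z : exists A B : set (sphere R),
    [/\ nbhs (fin z) A, nbhs (infty : sphere R) B & A `&` B = set0].
  exists [set x | if x is Some y then cabs y < cabs z + 1 else False].
  exists [set x | if x is Some y then cabs z + 1 < cabs y else True]; split.
  - apply/nbhs_finP; exists 1 => // y /= yz.
    by have := cabs_sub y z; rewrite lerBlDl => /le_lt_trans; apply; rewrite ltrD2l.
  - by apply/nbhs_inftyP; split => //; exists (cabs z + 1).
  - apply/seteqP; split=> // -[y|] /= [yz zy] //.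
    by have := lt_trans yz zy; rewrite ltxx.
move=> x y xy; apply: contrapT => neq.
suff [A [B [nA nB AB]]] : exists A B : set (sphere R),
    [/\ nbhs x A, nbhs y B & A `&` B = set0].
  by have := xy A B nA nB; rewrite AB => -[].
case: x y neq {xy} => [z|] [w|] neq; last by case: neq.
- have zw : 0 < cabs (z - w) / 2.
    by rewrite divr_gt0 // cabs_gt0 subr_eq0; apply: contra_notN neq => /eqP ->.
  exists [set x | if x is Some y then cabs (y - z) < cabs (z - w) / 2 else False].
  exists [set x | if x is Some y then cabs (y - w) < cabs (z - w) / 2 else False]; split.
  + by apply/nbhs_finP; exists (cabs (z - w) / 2).
  + by apply/nbhs_finP; exists (cabs (z - w) / 2).
  + apply/seteqP; split=> // -[y|] /= [yz yw] //.
    have := cabs_triangle y z w; rewrite [cabs (z - y)]cabsB leNgt => /negP; apply.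
    by rewrite [X in _ < X]splitr ltrD.
- exact: fin_infty.
- by have [A [B [? ? AB]]] := fin_infty w; exists B, A; rewrite setIC.
Qed.

(** A continuous injection of a compact space into a Hausdorff space is a closed map, so its inverse
    is continuous on the image. *)
Lemma continuous_injective_homeo (F : sphere R -> sphere R) :
  continuous F -> injective F -> homeo_onto_image [set: sphere R] F.
Proof.
move=> Fc Fi; split; first exact: continuous_subspaceT.
have [G GF] : exists G : sphere R -> sphere R, forall z : sphere R, G (F z) = z.
  (* Outside the image of F the value [infty] is a default. *)
  pose G (y : sphere R) : sphere R :=
    if pselect (exists z : sphere R, F z = y) is left e then projT1 (cid e) else infty.
  exists G => z; rewrite /G; case: pselect => [e|]; last by case; exists z.
  by case: (cid e) => /= w /Fi.
exists G; split=> //; apply/continuous_closedP => B cB.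
apply/closed_subspaceP; exists (F @` B).
  apply: compact_closed; first exact: sphere_hausdorff.
  apply: continuous_compact; first exact: continuous_subspaceT.
  apply: (@subclosed_compact _ B setT cB) => //.
  exact: (@one_point_compactification_compact (cplx R)).
apply/seteqP; split=> [y [[x Bx <-] _]|y [/= By [x _ xy]]].
  by split; [change (B (G (F x))); rewrite GF | exists x].
have Bx : B x by rewrite -(GF x) xy.
by rewrite -xy; split; exists x.
Qed.

End SphereTopology.

Section PerturbedInversion.
Variables (R : realType) (k : R) (c : cplx R).
Variables (F : sphere R -> sphere R) (psi : cplx R -> cplx R).
Hypothesis k01 : 0 <= k < 1.
Hypothesis psi_lipschitz : forall x y : cplx R, cabs (psi x - psi y) <= k * cabs (x - y).
Hypothesis F_fin : forall z : cplx R, z != c ->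
  F (fin z) = fin (1 / (z - c) + psi (1 / (z - c))).
Hypothesis F_pole : F (fin c) = infty.
Hypothesis F_infty : F infty = fin (psi 0).
Implicit Types (z w x y u : cplx R).

Let T w := w + psi w.

Let k0 : 0 <= k. Proof. by case/andP: k01. Qed.
Let k1 : 0 < 1 - k. Proof. by case/andP: k01; rewrite subr_gt0. Qed.

Lemma perturbed_identity_le x y : cabs (T x - T y) <= (1 + k) * cabs (x - y).
Proof.
have -> : T x - T y = (x - y) + (psi x - psi y) by rewrite /T; ring.
by apply: le_trans (cabsD _ _) _; rewrite mulrDl mul1r lerD2l.
Qed.

(** Used twice: it makes T injective, and it forces T w to infinity with w, which is continuity of F
    at the pole. *)
Lemma perturbed_identity_ge x y : (1 - k) * cabs (x - y) <= cabs (T x - T y).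
Proof.
have := cabs_sub (x - y) (- (psi x - psi y)); rewrite cabsN opprK.
have -> : x - y + (psi x - psi y) = T x - T y by rewrite /T; ring.
by apply: le_trans; rewrite mulrBl mul1r lerD2l lerN2.
Qed.

Let T_inj : injective T.
Proof.
move=> x y xy; have := perturbed_identity_ge x y; rewrite xy subrr cabs0.
rewrite pmulr_rle0 // le_eqVlt ltNge cabs_ge0 orbF cabs_eq0 subr_eq0.
by move/eqP.
Qed.

Let inv_neq0 z : z != c -> 1 / (z - c) != 0.
Proof. by rewrite -subr_eq0 div1r invr_eq0. Qed.

Lemma perturbed_inversion_injective : injective F.
Proof.
have inj_fin z w : z != c -> w != c -> F (fin z) = F (fin w) -> z = w.
  move=> zc wc; rewrite !F_fin // => -[] /T_inj; rewrite !div1r => /invr_inj.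
  exact: addIr.
have ninf z : z != c -> F (fin z) <> F infty.
  move=> zc; rewrite F_fin // F_infty => -[] E.
  have : T (1 / (z - c)) = T 0 by rewrite /T E add0r.
  by move/T_inj/eqP; rewrite (negbTE (inv_neq0 zc)).
case=> [z|] [w|] //; rewrite -?[Some _]/(fin _) -?[None]/infty.
- have [->|zc] := eqVneq z c; have [->|wc] := eqVneq w c => //.
  + by rewrite F_pole F_fin.
  + by rewrite F_pole F_fin.
  + by move=> /inj_fin ->.
- have [->|zc] := eqVneq z c; first by rewrite F_pole F_infty.
  by move/ninf.
- have [->|wc] := eqVneq w c; first by rewrite F_pole F_infty.
  by move/esym/ninf.
Qed.

Let T_cont x : {for x, continuous T}.
Proof.
by apply: (@lipschitz_continuous_cplx _ _ (1 + k));
  [rewrite addr_ge0 | exact: perturbed_identity_le].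
Qed.

Lemma perturbed_inversion_continuous : continuous F.
Proof.
case=> [z|] P; rewrite -?[Some _]/(fin _) -?[None]/infty.
  have [->|zc] := eqVneq z c.
    rewrite F_pole => /nbhs_inftyP [Pi [M MP]]; apply/nbhs_finP.
    (* |T w| >= (1 - k)|w| - |psi 0| must exceed M, and y closer to c than (1 - k)/N gives (1 -
       k)|w| > N for w = 1/(y - c). *)
    pose N := `|M| + cabs (psi 0) + 1.
    have N0 : 0 < N by rewrite ltr_wpDl // addr_ge0 ?cabs_ge0.
    exists ((1 - k) / N); first by rewrite divr_gt0.
    move=> y yc /=; have [->|yc0] := eqVneq y c; first by rewrite F_pole.
    rewrite F_fin //; apply: MP; have d0 : 0 < cabs (y - c) by rewrite cabs_gt0 subr_eq0.
    have := perturbed_identity_ge (1 / (y - c)) 0.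
    rewrite subr0 {2}/T add0r cabsM cabs1 mul1r cabsV => h.
    have h2 : N < (1 - k) / cabs (y - c).
      by move: yc; rewrite ltr_pdivlMr // ltr_pdivlMr // mulrC.

    have h3 := le_trans h (cabsD (T (1 / (y - c))) (- psi 0)).
    rewrite cabsN in h3; have := lt_le_trans h2 h3.
    rewrite /N => h4; change (M < cabs (T (1 / (y - c)))).
    by have := ler_norm M; lra.
  rewrite F_fin // => /nbhs_finP [e e0 eP].
  have zc0 : z - c != 0 by rewrite subr_eq0.
  have [d1 d10 hd1] := (continuous_cplx T (1 / (z - c))).1 (@T_cont _) _ e0.
  have [C [d2 [C0 d20 hd2]]] := real_diff_bounded (real_diff_inv zc0).
  apply/nbhs_finP; exists (Num.min (cabs (z - c)) (Num.min d2 (d1 / C))).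
    by rewrite !lt_min d20 divr_gt0 // cabs_gt0 zc0.
  move=> y; rewrite !lt_min => /and3P[yz y2]; rewrite ltr_pdivlMr // => y1 /=.
  have yc : y != c by apply: contraTneq yz => ->; rewrite cabsB ltxx.
  rewrite F_fin //; apply: eP; apply: hd1; rewrite !div1r.
  have := hd2 (y - z) y2; have -> : z - c + (y - z) = y - c by ring.
  by move=> /le_lt_trans; apply; rewrite mulrC.
rewrite F_infty => /nbhs_finP [e e0 eP].
have [d d0 hd] := (continuous_cplx T 0).1 (@T_cont _) _ e0.
have T0 : T 0 = psi 0 by rewrite /T add0r.
apply/nbhs_inftyP; split; first by rewrite /= F_infty; apply: eP; rewrite subrr cabs0.
(* Beyond this modulus |z - c| > 1/d, so 1/(z - c) is within d of 0. *)
exists (cabs c + d^-1) => z; rewrite addrC -ltrBrDr => zd /=.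
have zc : d^-1 < cabs (z - c) by apply: lt_le_trans zd (cabs_sub _ _).
have zc0 : 0 < cabs (z - c) by apply: lt_trans zc; rewrite invr_gt0.
have zcn : z != c by rewrite -subr_eq0 -cabs_gt0.
rewrite F_fin //; apply: eP; rewrite -T0; apply: hd.
by rewrite subr0 div1r cabsV -[ltRHS]invrK ltf_pV2 ?posrE ?invr_gt0.
Qed.

Lemma perturbed_inversion_homeo : homeo_onto_image [set: sphere R] F.
Proof.
exact: continuous_injective_homeo perturbed_inversion_continuous perturbed_inversion_injective.
Qed.

End PerturbedInversion.

(** * Arguments and winding numbers *)

Section Winding.
Variable R : realType.
Implicit Types (z w : cplx R).

Lemma cisD (s t : R) : cis (s + t) = cis s * cis t :> cplx R.
Proof. by rewrite /cis cosD sinD; congr (_ +i* _); rewrite addrC. Qed.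

Lemma cabs_cis (t : R) : cabs (cis t) = 1.
Proof.
apply/eqP; rewrite -(@eqrXn2 _ 2) ?cabs_ge0 // expr1n sqr_cabs /cis /=.
by rewrite cos2Dsin2.
Qed.

Lemma cis_continuous : continuous (@cis R).
Proof.
move=> t P /nbhs_cplx [d d0 dP]; have d2 : 0 < d / 2 by rewrite divr_gt0.
have /cvgrPdist_lt /(_ _ d2) hc := @continuous_cos R t.
have /cvgrPdist_lt /(_ _ d2) hs := @continuous_sin R t.
near=> s; apply: dP; apply: le_lt_trans (cabs_le_ReIm _) _.
rewrite ReB ImB /= [d]splitr; apply: ltrD; rewrite distrC; near: s; [exact: hc|exact: hs].
Unshelve. all: by end_near. Qed.

Lemma Re_continuous : continuous (@complex.Re R : cplx R -> R).
Proof.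
move=> z P /nbhs_ballP [e e0 eP]; apply/nbhs_cplx; exists e => // y yz.
by apply: eP; rewrite /ball /= -ReB; apply: le_lt_trans (Re_le_cabs _) _; rewrite cabsB.
Qed.

Lemma Im_continuous : continuous (@complex.Im R : cplx R -> R).
Proof.
move=> z P /nbhs_ballP [e e0 eP]; apply/nbhs_cplx; exists e => // y yz.
by apply: eP; rewrite /ball /= -ImB; apply: le_lt_trans (Im_le_cabs _) _; rewrite cabsB.
Qed.

(** In the right half-plane atan (y/x) is a continuous argument, which provides a continuous lift
    without any covering theory. *)
Lemma polar_half_plane z : 0 < complex.Re z ->
  z = (cabs z)%:C * cis (atan (complex.Im z / complex.Re z)).
Proof.
move=> z0; set x := complex.Re z; set y := complex.Im z.
set b := atan _; have cb : 0 < cos b.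
  by rewrite cos_gt0_pihalf // atan_gtNpi2 atan_ltpi2.
have sb : sin b = y / x * cos b.
  by rewrite -[y / x](@atanK R) -/b /tan mulfVK // gt_eqF.
have cx : cabs z * cos b = x.
  apply/eqP; rewrite -(@eqrXn2 _ 2) ?mulr_ge0 ?cabs_ge0 ?(ltW cb) ?(ltW z0) //.
  rewrite exprMn sqr_cabs -/x -/y.
  have : cos b ^+ 2 + (y / x * cos b) ^+ 2 = 1 by rewrite -sb cos2Dsin2.
  have x0 : x != 0 by rewrite gt_eqF.
  move=> e; apply/eqP; transitivity (x ^+ 2 * (cos b ^+ 2 + (y / x * cos b) ^+ 2)).
    by field.
  by rewrite e mulr1.
have sx : cabs z * sin b = y by rewrite sb mulrCA cx mulfVK // gt_eqF.
case: z @x @y z0 b cb sb cx sx => x0 y0 /= z0 b cb sb cx sx.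
by congr (_ +i* _); rewrite mul0r ?subr0 ?addr0.
Qed.

(** One argument of one point, with no continuity claimed; it is applied to the constant factor C
    below. *)
Lemma polar_exists z : z != 0 -> exists a : R, z = (cabs z)%:C * cis a.
Proof.
move=> z0; have cz : 0 < cabs z by rewrite cabs_gt0.
pose x := complex.Re z / cabs z.
have x1 : -1 <= x <= 1.
  by rewrite -ler_norml /x normrM normfV (ger0_norm (cabs_ge0 _)) ler_pdivrMr // mul1r Re_le_cabs.
have cx : cos (acos x) = x by rewrite acosK.
have sx : sin (acos x) = `|complex.Im z| / cabs z.
  rewrite sin_acos //; apply/eqP; rewrite -(@eqrXn2 _ 2) ?sqrtr_ge0 ?divr_ge0 ?cabs_ge0 //.
  rewrite sqr_sqrtr; last by rewrite subr_ge0 -real_normK ?num_real // expr_le1 // ler_norml.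
  rewrite /x !expr_div_n real_normK ?num_real // sqr_cabs.
  have : cabs z ^+ 2 != 0 by rewrite gt_eqF // exprn_gt0.
  by rewrite sqr_cabs => nz; apply/eqP; field.
have [y0|y0] := leP 0 (complex.Im z).
  exists (acos x); rewrite /cis cx sx ger0_norm //.
  have cz0 : cabs z != 0 by rewrite gt_eqF.
  rewrite /x; case: (z) cz0 => u v /= cz0; congr (_ +i* _); field; exact: cz0.
exists (- acos x); rewrite /cis cosN sinN cx sx ltr0_norm //.
have cz0 : cabs z != 0 by rewrite gt_eqF.
rewrite /x; case: (z) cz0 => u v /= cz0; congr (_ +i* _); field; exact: cz0.
Qed.

(* Near z the map is u |-> u C q(u) + w with |q - 1| < 1, so the increment of
   the argument along a small circle is that of u. *)
Lemma winding_number_small_circle (G : cplx R -> cplx R) (C w : cplx R) (r : R) :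
  0 < r -> C != 0 ->
  (forall u, cabs u = r -> {for u, continuous G}) ->
  (forall u, cabs u = r -> cabs ((G u - w) / (u * C) - 1) < 1) ->
  winding_number (fun t => G (r%:C * cis (2 * pi * t))) w 1.
Proof.
move=> r0 C0 Gc Gq; have [al alC] := polar_exists C0.
pose u (t : R) : cplx R := r%:C * cis (2 * pi * t).
pose q t := (G (u t) - w) / (u t * C).
have ur t : cabs (u t) = r by rewrite /u cabsM cabs_cis cabs_real mulr1 gtr0_norm.
have u0 t : u t != 0 by rewrite -cabs_gt0 ur.
have q0 t : 0 < complex.Re (q t).
  have := Gq _ (ur t); rewrite -/(q t) => q1.
  have := le_lt_trans (Re_le_cabs _) q1; rewrite ReB /= ltr_norml => /andP[+ _].
  by rewrite ltrBrDl subrr.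
(* The arguments of the circle, of C and of q add up; |q - 1| < 1 puts q in the right half-plane,
   where atan is available. *)
pose theta (t : R) := 2 * pi * t + al + atan (complex.Im (q t) / complex.Re (q t)).
have uc : continuous u.
  move=> t; apply: cvgM; first exact: cvg_cst.
  apply: (@continuous_comp _ _ _ (fun t => 2 * pi * t) (@cis R)).
    by apply: cvgM; [exact: cvg_cst | exact: cvg_id].
  exact: cis_continuous.
have qc : continuous q.
  move=> t; apply: cvgM.
    apply: cvgB; last exact: cvg_cst.
    apply: (@continuous_comp _ _ _ u G); [exact: uc | exact/Gc/ur].
  apply: cvgV; first exact: mulf_neq0.
  by apply: cvgM; [exact: uc | exact: cvg_cst].
exists theta; split.
- apply: continuous_subspaceT => t; apply: cvgD.
    apply: cvgD; last exact: cvg_cst.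
    by apply: cvgM; [exact: cvg_cst | exact: cvg_id].
  apply: (@continuous_comp _ _ _ (fun t => complex.Im (q t) / complex.Re (q t)) atan);
    last exact: continuous_atan.
  apply: cvgM.
    by apply: (@continuous_comp _ _ _ q (@complex.Im R)); [exact: qc | exact: Im_continuous].
  apply: cvgV; first exact/lt0r_neq0/q0.
  by apply: (@continuous_comp _ _ _ q (@complex.Re R)); [exact: qc | exact: Re_continuous].
- move=> t _; rewrite -/(u t).
  have qn0 : q t != 0 by apply: contraTneq (q0 t) => ->; rewrite ltxx.
  have E : G (u t) - w = u t * C * q t.
    by rewrite /q [RHS]mulrC mulfVK // mulf_neq0.
  split; first by rewrite -subr_eq0 E; do 2!apply: mulf_neq0 => //.
  have cE : cabs (u t * C * q t) = r * cabs C * cabs (q t).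
    by rewrite -(ur t); move: (u t) => v; rewrite !cabsM.
  rewrite normE E cE {1}alC {1}(polar_half_plane (q0 t)).
  by rewrite /theta !cisD /u !realM; ring.
rewrite /theta /q.
(* The loop closes, so the atan terms cancel and only 2 pi remains. *)
have -> : u 1 = u 0.
  rewrite /u mulr1 mulr0 /cis cos0 sin0; congr (_ * (_ +i* _)).
    by rewrite mulr_natl cos2pi.
  by rewrite mulr_natl sin2pi.
by rewrite mulr0 mulr1 mul1r; ring.
Qed.

End Winding.

(** * Sense preservation of the perturbed inversion *)

Section Orientation.
Variables (R : realType) (k : R) (c : cplx R).
Variables (F : sphere R -> sphere R) (psi : cplx R -> cplx R).
Hypothesis k01 : 0 <= k < 1.
Hypothesis psi_lipschitz : forall x y : cplx R, cabs (psi x - psi y) <= k * cabs (x - y).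
Hypothesis F_fin : forall z : cplx R, z != c ->
  F (fin z) = fin (1 / (z - c) + psi (1 / (z - c))).
Hypothesis F_pole : F (fin c) = infty.
Implicit Types (z w x y u : cplx R).

Let k0 : 0 <= k. Proof. by case/andP: k01. Qed.
Let k1 : 0 < 1 - k. Proof. by case/andP: k01; rewrite subr_gt0. Qed.

(** Compare the increment of F with - u/s^2, the linear part of the inversion at s = z - c. The
    relative error is at most (r + k |s|)/|s + u|, where k |s|/|s + u| is the share of psi. *)
Lemma perturbed_inversion_winding z w : F (fin z) = fin w ->
  exists2 d : R, 0 < d & forall r, 0 < r < d -> exists gamma : R -> cplx R,
    (forall t, F (fin (z + r%:C * cis (2 * pi * t))) = fin (gamma t)) /\
    winding_number gamma w 1.
Proof.
have [->|zc] := eqVneq z c; first by rewrite F_pole.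
rewrite F_fin // => -[<-]; pose s := z - c.
have s0 : s != 0 by rewrite subr_eq0.
have cs : 0 < cabs s by rewrite cabs_gt0.
(* Exactly what makes r + k |s| < |s| - r <= |s + u|, so that the relative error is below 1. *)
exists ((1 - k) * cabs s / 2); first by rewrite divr_gt0 // mulr_gt0.
move=> r /andP[r0]; rewrite ltr_pdivlMr // => rs.
have ks : 0 <= k * cabs s by rewrite mulr_ge0 ?cabs_ge0.
have su u : cabs u = r -> r + k * cabs s < cabs (s + u).
  move=> ur; have := cabs_sub s (- u); rewrite cabsN opprK ur.
  by apply: lt_le_trans; lra.
have su0 u : cabs u = r -> s + u != 0.
  by move=> /su h; rewrite -cabs_gt0; apply: lt_trans h; rewrite ltr_pwDl.
pose G u := 1 / (s + u) + psi (1 / (s + u)).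
exists (fun t => G (r%:C * cis (2 * pi * t))); split.
  move=> t; set u := r%:C * _.
  have ur : cabs u = r by rewrite /u cabsM cabs_cis cabs_real mulr1 gtr0_norm.
  have zuc : z + u != c by have := su0 u ur; rewrite /s -addrAC subr_eq0.
  by rewrite F_fin // /G /s addrAC.
apply: (@winding_number_small_circle _ G (- s ^- 2)) => //.
- by rewrite oppr_eq0 invr_eq0 expf_neq0.
- move=> u ur; apply/continuous_cplx => e e0.
  have [C [d [C0 d0 hC]]] := real_diff_bounded (real_diff_inv (su0 u ur)).
  have K0 : 0 < (1 + k) * C by rewrite mulr_gt0 // ltr_pwDl.
  exists (Num.min d (e / ((1 + k) * C))); first by rewrite lt_min d0 divr_gt0.
  move=> v; rewrite lt_min => /andP[vd]; rewrite ltr_pdivlMr // => ve.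
  apply: le_lt_trans ve; apply: le_trans (perturbed_identity_le psi_lipschitz _ _) _.
  rewrite [leRHS]mulrC -mulrA; apply: ler_wpM2l; first by rewrite addr_ge0.
  have := hC (v - u) vd; have -> : s + u + (v - u) = s + v by ring.
  by rewrite !div1r.
move=> u ur; have u0 : u != 0 by rewrite -cabs_gt0 ur.
have h0 := su0 _ ur; have h1 := su _ ur.
have hu : 0 < cabs (s + u) by rewrite cabs_gt0.
pose D := psi (1 / (s + u)) - psi (1 / s).
have -> : (G u - (1 / s + psi (1 / s))) / (u * - s ^- 2) - 1 =
   - (u / (s + u)) + D / (u * - s ^- 2).
  by rewrite /G /D; field; rewrite h0 u0 s0.
apply: le_lt_trans (cabsD _ _) _; rewrite cabsN.
have Dle : cabs (D / (u * - s ^- 2)) <= k * cabs s / cabs (s + u).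
  rewrite cabsM cabsV ler_pdivrMr ?cabs_gt0 ?mulf_neq0 ?oppr_eq0 ?invr_eq0 ?expf_neq0 //.
  apply: le_trans (psi_lipschitz _ _) _.
  have -> : 1 / (s + u) - 1 / s = - u / (s * (s + u)) by field; rewrite h0 s0.
  have -> : cabs (- u / (s * (s + u))) = cabs u / (cabs s * cabs (s + u)).
    by rewrite cabsM cabsN cabsV cabsM.
  have -> : cabs (u * - s ^- 2) = cabs u / cabs s ^+ 2 by rewrite cabsM cabsN cabsV cabsX.
  rewrite le_eqVlt; apply/orP; left; apply/eqP.
  by field; rewrite !gt_eqF.
apply: le_lt_trans (lerD (lexx _) Dle) _.
by rewrite cabsM cabsV ur -mulrDl ltr_pdivrMr // mul1r.
Qed.

(** Stated for any f that agrees with F on an open set, so that it covers both F on the plane and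
    the given f on the disk. *)
Lemma perturbed_inversion_sense_preserving (U : set (cplx R)) (f : cplx R -> sphere R) :
  open U -> (forall z, U z -> f z = F (fin z)) -> sense_preserving U f.
Proof.
move=> oU fF z w Uz; rewrite fF // => Fz.
have [d d0 dP] := perturbed_inversion_winding Fz.
have /nbhs_cplx [e e0 eP] := open_nbhs_nbhs (conj oU Uz).
near=> r.
have r0 : 0 < r by near: r; exact: nbhs_right_gt.
have rd : r < d by near: r; exact: nbhs_right_lt.
have re : r < e by near: r; exact: nbhs_right_lt.
have [|gamma [Fg gw]] := dP r; first by rewrite r0.
exists gamma; split=> // t _; rewrite fF ?Fg //; apply: eP.
by rewrite addrC addKr cabsM cabs_cis cabs_real mulr1 gtr0_norm.
Unshelve. all: by end_near. Qed.

End Orientation.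

(** * Measurability and translation invariance in the plane *)

Section PlaneMeasure.
Variable R : realType.
Local Notation mu1 := (@lebesgue_measure R).
Local Notation mu2 := (mu1 \x mu1)%E.

(** The measurable structure of [R * R] is the product one, so an open set is written as a countable
    union of squares with rational centres. *)
Lemma open_measurable_plane (A : set (R * R)) : open A -> measurable A.
Proof.
move=> oA.
pose box (i : rat * rat * nat) : set (R * R) :=
  (`](ratr i.1.1 - i.2.+1%:R^-1), (ratr i.1.1 + i.2.+1%:R^-1)[ `*`
   `](ratr i.1.2 - i.2.+1%:R^-1), (ratr i.1.2 + i.2.+1%:R^-1)[)%classic.
(* Squares that stick out of A are replaced by the empty set, so the union runs over the whole
   countable index type. *)
pose F i := if `[< box i `<=` A >] then box i else set0.
have -> : A = \bigcup_i F i.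
  apply/seteqP; split=> [x Ax|x [i _]]; last first.
    by rewrite /F; case: asboolP => // sub /sub.
  have /nbhs_ballP [e /= e0 eA] := open_nbhs_nbhs (conj oA Ax).
  have [n ne] : exists n : nat, n.+1%:R^-1 < e / 2.
    have e20 : 0 < e / 2 by rewrite divr_gt0.
    have [n _ hn] := near_infty_natSinv_lt (PosNum e20).
    by exists n; apply: hn => /=.
  set r : R := n.+1%:R^-1 in ne.
  have r0 : 0 < r by rewrite invr_gt0.
  have approx (s : R) : exists q : rat, `|ratr q - s| < r.
    have [|q] := @rat_in_itvoo R (s - r) (s + r); first by rewrite ltrD2l gtrN.
    rewrite in_itv /= => /andP[h1 h2]; exists q.
    by rewrite ltr_norml; apply/andP; split; lra.
  have [q1 hq1] := approx x.1; have [q2 hq2] := approx x.2.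
  exists (q1, q2, n) => //; rewrite /F; case: asboolP => [sub|[]].
    split; rewrite /= in_itv /= -/r; apply/andP.
      by move: hq1; rewrite ltr_norml => /andP[h1 h2]; split; lra.
    by move: hq2; rewrite ltr_norml => /andP[h1 h2]; split; lra.
  move=> y [/=]; rewrite !in_itv /= -/r => /andP[a1 a2] /andP[b1 b2]; apply: eA.
  by split; rewrite /ball /= ltr_norml; apply/andP;
    [move: hq1 | move: hq2]; rewrite ltr_norml => /andP[h1 h2]; split; lra.
apply: countable_bigcupT_measurable; first exact: countableP.
move=> i; rewrite /F; case: asboolP => _; last exact: measurable0.
by rewrite /box; apply: measurableX; exact: measurable_itv.
Qed.

Lemma closed_measurable_plane (A : set (R * R)) : closed A -> measurable A.
Proof.
move=> cA; rewrite -[A]setCK; apply: measurableC; apply: open_measurable_plane.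
exact: closed_openC.
Qed.

Lemma continuous_measurable_plane (f : R * R -> R) :
  continuous f -> measurable_fun setT f.
Proof.
move=> /continuousP cf; apply: (measurability _ (RGenOpens.measurableE R)).
move=> _ [_ [a [b ->] <-]]; rewrite setTI; apply: open_measurable_plane.
exact/cf/interval_open.
Qed.

Definition closed_square (B : R) : set (R * R) :=
  [set x | `|x.1| <= B /\ `|x.2| <= B].

Lemma closed_squareE (B : R) : closed_square B = (`[- B, B] `*` `[- B, B])%classic.
Proof.
by apply/seteqP; split=> x /=; rewrite /closed_square /= !in_itv /= -!ler_norml.
Qed.

Lemma closed_square_measurable (B : R) : measurable (closed_square B).
Proof. by rewrite closed_squareE; apply: measurableX; exact: measurable_itv. Qed.

Lemma closed_square_finite (B : R) : (mu2 (closed_square B) < +oo)%E.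
Proof.
rewrite closed_squareE.
have h : (lebesgue_measure (`[(- B)%R, B]%classic : set R) < +oo)%E.
  by rewrite lebesgue_measure_itv /=; case: ifP => _; rewrite ?ltry // -EFinB ltry.
rewrite (product_measure1E mu1 mu1); [|exact: measurable_itv..].
by apply: lte_mul_pinfty => //; rewrite ge0_fin_numE.
Qed.

(** The pushforward by a shift agrees with Lebesgue measure on half-open intervals, and these
    determine it. The plane follows by uniqueness of product measures. *)
Lemma lebesgue_measure_shift (a : R) (A : set R) : measurable A ->
  mu1 ((fun x => x + a) @^-1` A) = mu1 A.
Proof.
have ms : measurable_fun setT ((fun x => x + a) : measurableTypeR R -> measurableTypeR R).
  exact: measurable_funD.
move=> mA; rewrite -[LHS]/(pushforward mu1 ((fun x => x + a) : _ -> measurableTypeR R) A).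
apply/esym/lebesgue_measure_unique => //= _ [[x y]] _ <-; rewrite /pushforward.
have -> : (fun x => x + a) @^-1` `]x, y]%classic = `]x - a, y - a]%classic.
  by apply/seteqP; split=> z /=; rewrite !in_itv /= ltrBlDr lerBrDr.
rewrite !lebesgue_measure_itv /= !lte_fin ltrD2r.
by case: ifP => // _; rewrite -!EFinB opprB addrA addrNK.
Qed.

Definition translate (a x : R * R) : R * R := x + a.

Lemma translate_measurable (a : R * R) : measurable_fun setT (translate a).
Proof.
apply/measurable_fun_pairP; split => /=.
  by apply: measurable_funD => //; exact: measurable_fst.
by apply: measurable_funD => //; exact: measurable_snd.
Qed.

Lemma plane_measure_translate (a : R * R) (A : set (R * R)) : measurable A ->
  mu2 (translate a @^-1` A) = mu2 A.
Proof.
pose T2 := (measurableTypeR R * measurableTypeR R)%type.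
pose sh : T2 -> T2 := translate a.
have msh : measurable_fun setT sh by exact: translate_measurable.
move=> mA; apply/esym.
have V := @product_measure_unique _ _ _ _ R mu1 mu1 (pushforward mu2 sh).
apply: (V msh) => // B C mB mC.
rewrite /pushforward.
transitivity (mu2 (((fun x => x + a.1) @^-1` B) `*` ((fun x => x + a.2) @^-1` C))) => //.
rewrite product_measure1E; first by congr (_ * _)%E; exact: lebesgue_measure_shift.
  by rewrite -[X in measurable X]setTI; exact: measurable_funD.
by rewrite -[X in measurable X]setTI; exact: measurable_funD.
Qed.

Lemma plane_integral_translate (a : R * R) (f : R * R -> \bar R) :
  measurable_fun setT f -> mu2.-integrable setT (f \o translate a) ->
  (\int[mu2]_x (f \o translate a) x = \int[mu2]_x f x)%E.
Proof.
move=> mf intf.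
pose T2 := (measurableTypeR R * measurableTypeR R)%type.
pose sh : T2 -> T2 := translate a.
have msh : measurable_fun setT sh by exact: translate_measurable.
have E := @integral_pushforward _ _ T2 T2 R sh msh mu2 setT f mf intf measurableT.
rewrite -[LHS]E; apply: eq_measure_integral => A mA _.
exact: plane_measure_translate.
Qed.

End PlaneMeasure.

(** * Test functions and their bounds *)

Section TestFunctions.
Variable R : realType.
Implicit Types (x y : R * R) (U K : set (R * R)).

Lemma compact_bounded_fun K (f : R * R -> R) : compact K ->
  {within K, continuous f} -> exists2 M : R, 0 <= M & forall x, K x -> `|f x| <= M.
Proof.
move=> cK fc; have := continuous_compact fc cK.
move=> /compact_bounded [M [_ /(_ (`|M| + 1))]].
rewrite (le_lt_trans (ler_norm M)) ?ltrDl // => /(_ isT) KM.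
by exists (`|M| + 1); [rewrite addr_ge0 | move=> x Kx; apply: KM; exists x].
Qed.

Lemma compact_coord_bounded K : compact K -> exists2 B : R, 0 <= B &
  forall x, K x -> `|x.1| <= B /\ `|x.2| <= B.
Proof.
move=> cK.
have [M1 M10 h1] : exists2 M : R, 0 <= M & forall x, K x -> `|x.1| <= M.
  by apply: compact_bounded_fun => //; apply: continuous_subspaceT => x; exact: cvg_fst.
have [M2 M20 h2] : exists2 M : R, 0 <= M & forall x, K x -> `|x.2| <= M.
  by apply: compact_bounded_fun => //; apply: continuous_subspaceT => x; exact: cvg_snd.
exists (M1 + M2) => [|x Kx]; first exact: addr_ge0.
by split; [apply: le_trans (h1 _ Kx) _; rewrite lerDl | apply: le_trans (h2 _ Kx) _; rewrite lerDr].
Qed.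

Lemma line_is_derive (f : R * R -> R) x v (t : R) : derivable f (x + t *: v) v ->
  is_derive t (1 : R) (fun s => f (x + s *: v)) ('D_v f (x + t *: v)).
Proof.
move=> fd.
have E : (fun h : R => h^-1 *: (((fun s => f (x + s *: v)) \o shift t) (h *: (1 : R))
     - f (x + t *: v)))
   = (fun h => h^-1 *: ((f \o shift (x + t *: v)) (h *: v) - f (x + t *: v))).
  apply/funext => h; congr (_ *: (_ - _)); rewrite /= ; congr f.
  have -> : h *: (1 : R) = h by rewrite /GRing.scale /= mulr1.
  by rewrite scalerDl addrCA.
by apply: DeriveDef; rewrite /derivable /derive /= E.
Qed.

Lemma mean_value_line (f : R * R -> R) x v (M : R) :
  (forall y, derivable f y v) -> (forall y, `|'D_v f y| <= M) ->
  forall h : R, 0 <= h -> `|f (x + h *: v) - f x| <= M * h.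
Proof.
move=> fd fM h h0.
have dv t := line_is_derive (fd (x + t *: v)).
have [|s _] := @MVT_segment R (fun s => f (x + s *: v)) (fun s => 'D_v f (x + s *: v)) 0 h h0.
  apply: derivable_within_continuous => t _; have := dv t => ?; exact: ex_derive.
rewrite scale0r addr0 subr0 => ->; rewrite normrM (ger0_norm h0).
by apply: ler_wpM2r.
Qed.

Lemma ball_axis (b : bool) x (h d : R) : `|h| < d -> ball x d (x + h *: axis R b).
Proof.
move=> hd; have d0 : 0 < d by apply: le_lt_trans hd.
have scE (s : R) : h *: s = h * s by [].
by case: b; split; rewrite /ball /= scE ?mulr1 ?mulr0 ?addr0 ?subrr ?normr0 //
  opprD addrA subrr sub0r normrN.
Qed.

(** What integration by parts in one direction draws from a test function, with a single compact set
    and a single bound for the function and its derivative. *)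
Record test_data (b : bool) K U (phi : R * R -> R) (M : R) : Prop := TestData {
  test_compact : compact K;
  test_closed : closed K;
  test_sub : K `<=` U;
  test_continuous : continuous phi;
  test_derivable : forall x, derivable phi x (axis R b);
  test_partial_continuous : continuous (partial b phi);
  test_supp : forall x, ~ K x -> phi x = 0;
  test_partial_supp : forall x, ~ K x -> partial b phi x = 0;
  test_bound0 : 0 <= M;
  test_bound : forall x, `|phi x| <= M;
  test_partial_bound : forall x, `|partial b phi x| <= M
}.

Lemma test_functionP (b : bool) U phi : test_function U phi ->
  exists K M, test_data b K U phi M.
Proof.
rewrite /test_function; set K := closure _ => -[cls cK KU].
have cphi : continuous phi by move=> x; have [] := cls 0%N [::] isT x I.
have dphi x : derivable phi x (axis R b).
  by have [_ /(_ isT b)] := cls 1%N [::] isT x I.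
have cpar : continuous (partial b phi).
  by move=> x; have [] := cls 1%N [:: b] isT x I.
have K0 : closed K by exact: closed_closure.
have supp x : ~ K x -> phi x = 0.
  by move=> nK; apply/eqP; apply: contrapT => /negP nz; apply: nK; exact: subset_closure.
(* K is closed, so phi vanishes on a ball around x and the difference quotients are eventually 0. *)
have psupp x : ~ K x -> partial b phi x = 0.
  move=> nK; rewrite /partial /derive; apply/cvg_lim => //.
  have nbK : nbhs x (~` K) by apply: open_nbhs_nbhs; split=> //; exact: closed_openC.
  have /nbhs_ballP [e /= e0 eK] := nbK.
  rewrite (supp _ nK); apply: cvg_near_cst.
  have : \forall h \near (0 : R)^', `|h| < e.
    by apply: dnbhs0_lt.
  apply: filterS => h he; rewrite /= supp ?subr0 ?scaler0 //; apply: eK.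
  by rewrite addrC; exact: ball_axis.
have [M1 M10 h1] := compact_bounded_fun cK (continuous_subspaceT cphi).
have [M2 M20 h2] := compact_bounded_fun cK (continuous_subspaceT cpar).
exists K, (M1 + M2); split=> //; first exact: addr_ge0.
- move=> x; have [Kx|nK] := pselect (K x); last by rewrite supp // normr0 addr_ge0.
  by apply: le_trans (h1 _ Kx) _; rewrite lerDl.
- move=> x; have [Kx|nK] := pselect (K x); last by rewrite psupp // normr0 addr_ge0.
  by apply: le_trans (h2 _ Kx) _; rewrite lerDr.
Qed.

End TestFunctions.

(** * Weak derivatives of Lipschitz functions *)

(* The product of u and a test function is Lipschitz with compact support: the
   integrals of its difference quotients vanish by translation invariance, and
   dominated convergence passes to the almost everywhere derivative. *)
Section WeakDerivative.
Variables (R : realType) (b : bool).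
Local Notation mu1 := (@lebesgue_measure R).
Local Notation mu2 := (mu1 \x mu1)%E.
Local Notation e := (axis R b).
Variables (U E : set (R * R)) (u w : R * R -> R).
Hypothesis U_open : open U.
Hypothesis u_continuous : {in U, continuous u}.
Hypothesis w_measurable : measurable_fun U w.
Hypothesis E_measurable : measurable E.
Hypothesis E_null : mu2 E = 0%E.
Hypothesis u_derive : forall x, U x -> ~ E x -> is_derive x e u (w x).
Hypothesis u_lipschitz : forall K, compact K -> K `<=` U ->
  exists d M : R, [/\ 0 < d, 0 <= M & forall x (h : R), K x -> `|h| < d ->
    `|u (x + h *: e) - u x| <= M * `|h|].
Implicit Types (x : R * R).

Section IntegrationByParts.
Variables (phi : R * R -> R) (K : set (R * R)) (M : R).
Hypothesis phiT : test_data b K U phi M.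

Let v x := u x * phi x.
Let f x := u x * partial b phi x + w x * phi x.

Let U_near x : U x -> {for x, continuous u}.
Proof. by move=> Ux; apply: u_continuous; rewrite inE. Qed.

(** u is continuous only on U; the factor r vanishes off the closed set K inside U, which makes the
    product continuous everywhere. *)
Let supp_continuous (r : R * R -> R) :
  continuous r -> (forall x, ~ K x -> r x = 0) -> continuous (fun x => u x * r x).
Proof.
move=> rc r0 x; have [Kx|nK] := pselect (K x).
  by apply: cvgM; [exact/U_near/(test_sub phiT) | exact: rc].
rewrite /continuous_at r0 // mulr0; apply: cvg_near_cst.
have : nbhs x (~` K).
  by apply: open_nbhs_nbhs; split=> //; exact/closed_openC/(test_closed phiT).
by apply: filterS => y nKy; rewrite r0 // mulr0.
Qed.

Let v_continuous : continuous v.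
Proof. exact: supp_continuous (test_continuous phiT) (test_supp phiT). Qed.

Let up_continuous : continuous (fun x => u x * partial b phi x).
Proof. exact: supp_continuous (test_partial_continuous phiT) (test_partial_supp phiT). Qed.

Let wphi_measurable : measurable_fun setT (fun x => w x * phi x).
Proof.
have -> : (fun x => w x * phi x) = (fun x => (w \_ U) x * phi x).
  apply/funext => x; rewrite /patch; case: ifPn => // /negP xU.
  rewrite (test_supp phiT) ?mulr0 // => /(test_sub phiT) Ux.
  by apply: xU; rewrite inE.
apply: measurable_funM; last exact: continuous_measurable_plane (test_continuous phiT).
apply/(measurable_restrictT _ _).1 => //.
exact: open_measurable_plane.
Qed.

Let f_measurable : measurable_fun setT f.
Proof.
apply: measurable_funD; last exact: wphi_measurable.
exact: continuous_measurable_plane up_continuous.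
Qed.

Let box_integrable C B : mu2.-integrable setT (fun x => (C * \1_(closed_square B) x)%:E).
Proof.
have : mu2.-integrable setT (fun x => (C%:E * (\1_(closed_square B) x)%:E)%E).
  apply: integrableZl => //; apply/integrableP; split.
    by apply/measurable_EFinP; apply: measurable_indic; exact: closed_square_measurable.
  rewrite (@eq_integral _ _ _ mu2 setT (fun x => (\1_(closed_square B) x)%:E)); last first.
    by move=> x _; rewrite gee0_abs // lee_fin.
  rewrite (@integral_indic _ _ _ mu2 setT measurableT (closed_square B)
    (closed_square_measurable B)).
  change (mu2 (closed_square B `&` setT) < +oo)%E.
  by rewrite setIT; exact: closed_square_finite.
exact.
Qed.

(** On K this is the product rule off the null set; off K the function v vanishes near x. *)
Let step_cvg (h : nat -> R) : (forall n, 0 < h n) -> h @ \oo --> 0 ->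
  forall x, ~ E x -> (h n)^-1 * (v (x + h n *: e) - v x) @[n --> \oo] --> f x.
Proof.
move=> hp h0 x nE; have [Kx|nK] := pselect (K x).
  have du := u_derive (test_sub phiT Kx) nE.
  have dphi : is_derive x e phi (partial b phi x).
    by apply: DeriveDef => //; exact: (test_derivable phiT).
  have dv := is_deriveM du dphi.
  have vE : v = u * phi by [].
  have dd : derivable v x e by rewrite vE; exact: ex_derive.
  have fE : f x = 'D_e v x by rewrite vE derive_val /f [w x * _]mulrC.
  rewrite fE; move: dd; rewrite /derivable => /cvg_ex [l lv].
  have -> : 'D_e v x = l by apply/cvg_lim.
  have hh : h @ \oo --> (0 : R)^'.
    move=> P; rewrite /nbhs /= /dnbhs /within /= => /h0 hP.
    by move: hP; rewrite /nbhs /=; apply: filterS => n /=; apply; exact: lt0r_neq0.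
  have := cvg_comp _ _ hh lv.
  by under eq_fun do rewrite /= [_ *: e + x]addrC.
have -> : f x = 0.
  by rewrite /f (test_supp phiT) // (test_partial_supp phiT) // !mulr0 addr0.
rewrite /v (test_supp phiT nK) mulr0; apply: cvg_near_cst.
have /nbhs_ballP [d /= d0 dK] : nbhs x (~` K).
  by apply: open_nbhs_nbhs; split=> //; exact/closed_openC/(test_closed phiT).
have /cvgrPdist_lt /(_ _ d0) := h0; apply: filterS => n; rewrite sub0r normrN => hn.
rewrite (test_supp phiT) ?mulr0 ?subrr ?mulr0 //; apply: dK.
exact: ball_axis.
Qed.

Let u_bounded : exists2 C : R, 0 <= C & forall x, K x -> `|u x| <= C.
Proof.
apply: compact_bounded_fun; first exact: test_compact phiT.
apply: continuous_in_subspaceT => x /[!inE] Kx.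
exact/U_near/(test_sub phiT).
Qed.

(** The integrable majorant for dominated convergence. The box has half-width B + 1 because x or its
    translate, by less than 1, must lie in K. *)
Let v_translate_bound : exists C B d : R, [/\ 0 <= C, 0 < d &
  forall x (h : R), 0 < h -> h < d ->
    `|v (x + h *: e) - v x| <= h * (C * \1_(closed_square B) x)].
Proof.
have [C C0 uC] := u_bounded.
have [B B0 KB] := compact_coord_bounded (test_compact phiT).
have [d [L [d0 L0 uL]]] := u_lipschitz (test_compact phiT) (@test_sub _ _ _ _ _ _ phiT).
have M0 := test_bound0 phiT.
(* For x in K the translated value of u is at most C + L, as the shift is below 1; the two terms
   come from moving phi and moving u. *)
exists (M * (C + L) + M * L), (B + 1), (Num.min d 1); split.
- by rewrite addr_ge0 // mulr_ge0 // addr_ge0.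
- by rewrite lt_min d0 ltr01.
move=> x h h0; rewrite lt_min => /andP[hd h1].
set y := x + h *: e.
have phixy : `|phi y - phi x| <= M * h.
  by apply: mean_value_line (ltW h0); [exact: test_derivable phiT | exact: test_partial_bound phiT].
have [y1 y2] : y.1 = x.1 + h * (if b then 0 else 1) /\ y.2 = x.2 + h * (if b then 1 else 0).
  by rewrite /y /axis; case: (b).
have inbox : K x \/ K y -> \1_(closed_square (B + 1)) x = 1 :> R.
  move=> Kxy; rewrite indicE mem_set //.
  have near1 (s t : R) : `|s| <= B -> `|t - s| <= 1 -> `|t| <= B + 1.
    by move=> sB ts; rewrite -[t](subrK s) addrC; apply: le_trans (ler_normD _ _) (lerD _ _).
  have d1 : `|x.1 - y.1| <= 1 /\ `|x.2 - y.2| <= 1.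
    rewrite y1 y2; case: (b); rewrite ?mulr0 ?mulr1 ?addr0 ?subrr ?normr0 ?ler01 //
      opprD addrA subrr sub0r normrN gtr0_norm // ltW //.
  case: d1 => d1 d2; case: Kxy => [/KB [a1 a2]|/KB [a1 a2]].
    by split; apply: le_trans (_ : B <= _); rewrite ?lerDl.
  by split; [apply: near1 a1 d1 | apply: near1 a2 d2].
have [Kx|nKx] := pselect (K x).
  rewrite inbox ?mulr1; last by left.
  have uxy : `|u y - u x| <= L * h by have := uL x h Kx; rewrite (gtr0_norm h0); apply.
  have uy : `|u y| <= C + L.
    rewrite -[u y](subrK (u x)) addrC; apply: le_trans (ler_normD _ _) _.
    apply: lerD; first exact: uC.
    by apply: le_trans uxy _; rewrite ler_piMr // ltW.
  have -> : v y - v x = u y * (phi y - phi x) + phi x * (u y - u x) by rewrite /v; ring.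
  apply: le_trans (ler_normD _ _) _; rewrite !normrM mulrDr; apply: lerD.
    have -> : h * (M * (C + L)) = (C + L) * (M * h) by ring.
    by apply: ler_pM.
  have -> : h * (M * L) = M * (L * h) by ring.
  by have px := test_bound phiT x; apply: ler_pM.
have vx : v x = 0 by rewrite /v (test_supp phiT) // mulr0.
have [Ky|nKy] := pselect (K y); last first.
  rewrite vx /v (test_supp phiT nKy) mulr0 subrr normr0 mulr_ge0 ?(ltW h0) // mulr_ge0 //.
  by rewrite addr_ge0 // mulr_ge0 // addr_ge0.
rewrite inbox ?mulr1; last by right.
(* The Lipschitz bound on u starts from points of K, and here x is outside; phi x = 0 leaves only
   the variation of phi. *)
have -> : v y - v x = u y * (phi y - phi x).
  by rewrite vx /v (test_supp phiT nKx) !subr0.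
rewrite normrM; apply: (@le_trans _ _ (C * (M * h))).
  by have uy := uC _ Ky; apply: ler_pM.
have -> : h * (M * (C + L) + M * L) = C * (M * h) + h * (M * L + M * L) by ring.
by rewrite lerDl mulr_ge0 ?(ltW h0) // addr_ge0 // mulr_ge0.
Qed.

Let box_dominated_integrable (r : R * R -> R) (C B : R) : 0 <= C ->
  measurable_fun setT r -> (forall x, `|r x| <= C * \1_(closed_square B) x) ->
  mu2.-integrable setT (fun x => (r x)%:E).
Proof.
move=> C0 mr rC; apply: (@le_integrable _ _ _ mu2 setT measurableT _ _ _ _ (box_integrable C B)).
  exact/measurable_EFinP.
by move=> x _; rewrite /= lee_fin (le_trans (rC x)) // ler_norm.
Qed.

Let v_integrable : mu2.-integrable setT (fun x => (v x)%:E).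
Proof.
have [C C0 vC] := compact_bounded_fun (test_compact phiT) (continuous_subspaceT v_continuous).
have [B B0 KB] := compact_coord_bounded (test_compact phiT).
apply: (@box_dominated_integrable v C B) => //.
  exact: continuous_measurable_plane.
move=> x; have [Kx|nK] := pselect (K x).
  by rewrite indicE mem_set ?mulr1 ?vC //; exact: KB.
by rewrite /v (test_supp phiT) // mulr0 normr0 mulr_ge0.
Qed.

Let difference_integral (h C B : R) : 0 < h -> 0 <= C ->
  (forall x, `|v (x + h *: e) - v x| <= h * (C * \1_(closed_square B) x)) ->
  (\int[mu2]_x (h^-1 * (v (translate (h *: e) x) - v x))%:E = 0)%E.
Proof.
move=> h0 C0 vh.
have mv : measurable_fun setT v by exact: continuous_measurable_plane.
have mvt : measurable_fun setT (fun x => v (translate (h *: e) x)).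
  by apply: measurableT_comp => //; exact: translate_measurable.
have dint : mu2.-integrable setT (fun x => (v (translate (h *: e) x) - v x)%:E).
  apply: (@box_dominated_integrable _ (h * C) B).
  - by rewrite mulr_ge0 // ltW.
  - exact: measurable_funB.
  - by move=> x; rewrite -mulrA; exact: vh.
(* Integrability of the translate is read off from the dominated difference plus v; the change of
   variables asks for it. *)
have tint : mu2.-integrable setT (fun x => (v (translate (h *: e) x))%:E).
  have := integrableD measurableT dint v_integrable.
  apply: eq_integrable => // x _; rewrite /= -EFinD subrK //.
under eq_integral => x _ do rewrite EFinM.
rewrite integralZl //.
under eq_integral => x _ do rewrite EFinB.
rewrite integralB //.
have -> : (\int[mu2]_x (v (translate (h *: e) x))%:E = \int[mu2]_x (v x)%:E)%E.
  apply: (@plane_integral_translate R (h *: e) (EFin \o v)) => //.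
  exact/measurable_EFinP.
by rewrite subee ?mule0 //; exact: integrable_fin_num.
Qed.

Let f_integral : mu2.-integrable setT (fun x => (f x)%:E) /\
  (\int[mu2]_x (f x)%:E = 0)%E.
Proof.
have [C [B [d [C0 d0 vd]]]] := v_translate_bound.
have [n0 n0d] : exists n0 : nat, n0.+1%:R^-1 < d.
  have [n _ hn] := near_infty_natSinv_lt (PosNum d0).
  by exists n; apply: hn => /=.
(* The shift by n0 puts every step below d, so that the majorant holds for all n. *)
pose h n : R := (n + n0).+1%:R^-1.
have hp n : 0 < h n by rewrite invr_gt0.
have h0 : h @ \oo --> 0.
  by have := @cvg_harmonic R; rewrite -(cvg_shiftn n0).
have hd n : h n < d.
  by apply: le_lt_trans n0d; rewrite lef_pV2 ?posrE // ler_nat ltnS leq_addl.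
pose g n x := (h n)^-1 * (v (translate (h n *: e) x) - v x).
have mg n : measurable_fun setT (g n).
  apply: measurable_funM => //; apply: measurable_funB.
    apply: measurableT_comp; last exact: translate_measurable.
    exact: continuous_measurable_plane.
  exact: continuous_measurable_plane.
have [|||||intf _ lim] := @dominated_convergence _ _ R mu2 setT measurableT
  (fun n x => (g n x)%:E) (fun x => (f x)%:E) (fun x => (C * \1_(closed_square B) x)%:E).
- by move=> n; apply/measurable_EFinP; exact: mg.
- by apply/measurable_EFinP; exact: f_measurable.
- exists E; split => //; move=> x /= nx; apply: contrapT => nE; apply: nx => _.
  apply: cvg_EFin; first by near=> n.
  exact: step_cvg.
- exact: box_integrable.
- apply: aeW => x n _; rewrite /= lee_fin /g normrM gtr0_norm ?invr_gt0 //.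
  by rewrite ler_pdivrMl //; exact: vd.
split=> //; have : (fun n => \int[mu2]_x (g n x)%:E)%E @ \oo --> 0%E.
  apply: cvg_near_cst; near=> n; apply: (@difference_integral (h n) C B) => //.
  by move=> x; exact: vd.
by move=> lim0; apply: (cvg_unique _ lim lim0).
Unshelve. all: by end_near. Qed.

(** [f_integral] is the identity over the whole plane; both integrands vanish off K, which lies in
    U, so integrals over U are the same. *)
Lemma weak_partial_test :
  (\int[mu2]_(x in U) (u x * partial b phi x)%:E =
   - \int[mu2]_(x in U) (w x * phi x)%:E)%E.
Proof.
have mU : measurable U by exact: open_measurable_plane.
have onU (r : R * R -> R) : (forall x, ~ K x -> r x = 0) ->
  (\int[mu2]_(x in U) (r x)%:E = \int[mu2]_x (r x)%:E)%E.
  move=> r0; rewrite integral_mkcond; apply: eq_integral => x _.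
  rewrite /patch; case: ifPn => // /negP xU; rewrite r0 // => /(test_sub phiT) Ux.
  by apply: xU; rewrite inE.
rewrite !onU; last 2 first.
- by move=> x nK; rewrite (test_supp phiT) // mulr0.
- by move=> x nK; rewrite (test_partial_supp phiT) // mulr0.
have [fint f0] := f_integral.
have upint : mu2.-integrable setT (fun x => (u x * partial b phi x)%:E).
  have [C C0 vC] := compact_bounded_fun (test_compact phiT) (continuous_subspaceT up_continuous).
  have [B B0 KB] := compact_coord_bounded (test_compact phiT).
  apply: (@box_dominated_integrable _ C B) => //.
    exact: continuous_measurable_plane.
  move=> x; have [Kx|nK] := pselect (K x).
    by rewrite indicE mem_set ?mulr1 ?vC //; exact: KB.
  by rewrite (test_partial_supp phiT) // mulr0 normr0 mulr_ge0.
have wint : mu2.-integrable setT (fun x => (w x * phi x)%:E).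
  have := integrableB measurableT fint upint.
  by apply: eq_integrable => // x _; rewrite /= -EFinB /f addrC addKr.
have : (\int[mu2]_x (f x)%:E =
    \int[mu2]_x (u x * partial b phi x)%:E + \int[mu2]_x (w x * phi x)%:E)%E.
  by rewrite -integralD //.
have num (r : R * R -> R) : mu2.-integrable setT (fun x => (r x)%:E) ->
    exists s : R, (\int[mu2]_x (r x)%:E = s%:E)%E.
  by move=> rint; eexists; rewrite -[LHS]fineK; last exact: integrable_fin_num.
have [s1 ->] := num _ upint; have [s2 ->] := num _ wint.
by rewrite f0 -EFinD -EFinN => -[] /esym/eqP; rewrite addr_eq0 => /eqP ->.
Qed.

End IntegrationByParts.

Lemma weak_partial_lipschitz : weak_partial b U u w.
Proof.
move=> phi /test_functionP -/(_ b) [K [M phiT]].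
exact: weak_partial_test phiT.
Qed.

End WeakDerivative.

(** * The unit circle is null; directional derivatives from a real differential *)

Section CircleNull.
Variable R : realType.
Local Notation mu1 := (@lebesgue_measure R).
Local Notation mu2 := (mu1 \x mu1)%E.

Definition unit_circle : set (R * R) := [set x | cabs (pt x) = 1].

Lemma unit_circle_measurable : measurable unit_circle.
Proof.
apply: closed_measurable_plane.
have -> : unit_circle = (@cabs R \o @pt R) @^-1` [set 1] by [].
apply: closed_comp; last exact: closed_eq.
move=> x _; apply: (@continuous_comp _ _ _ (@pt R) (@cabs R)).
  exact: pt_continuous.
exact: cabs_continuous.
Qed.

(** Every vertical section has at most two points, and the product measure integrates the measures
    of the sections. *)
Lemma unit_circle_null : mu2 unit_circle = 0%E.
Proof.
rewrite /product_measure1; apply: integral0_eq => x _ /=.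
apply: countable_lebesgue_measure0.
pose s := Num.sqrt (1 - x ^+ 2).
apply: (@sub_countable _ _ _ [set s; - s]); last first.
  by apply: finite_set_countable; exact: finite_set2.
apply: subset_card_le => y; rewrite /xsection /= inE => xyc; have xy1 : cabs (pt (x, y)) = 1 := xyc.
have : y ^+ 2 = s ^+ 2.
  have := sqr_cabs (pt (x, y)); rewrite xy1 expr1n /= => e.
  by rewrite /s sqr_sqrtr e addrAC subrr add0r // sqr_ge0.
by move/eqP; rewrite eqf_sqr => /orP[/eqP ->|/eqP ->]; [left|right].
Qed.

Lemma open_continuous_measurable_plane (U : set (R * R)) (f : R * R -> R) :
  open U -> {in U, continuous f} -> measurable_fun U f.
Proof.
move=> oU fc; apply: (measurability _ (RGenOpens.measurableE R)).
move=> _ [_ [a [b ->] <-]]; apply: open_measurable_plane.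
rewrite openE => x [Ux fx]; apply: filterI; first exact: open_nbhs_nbhs.
by apply: fc; [rewrite inE | apply: open_nbhs_nbhs; split=> //; exact: interval_open].
Qed.

(** The derivative in a direction d is a d + b conj d, taken at d = 1 and d = i. *)
Lemma real_diff_is_derive (F : cplx R -> cplx R) (x : R * R) (a b : cplx R) :
  real_diff F (pt x) a b ->
  [/\ is_derive x (axis R false) (fun y => complex.Re (F (pt y))) (complex.Re (a + b)),
      is_derive x (axis R false) (fun y => complex.Im (F (pt y))) (complex.Im (a + b)),
      is_derive x (axis R true) (fun y => complex.Re (F (pt y))) (complex.Re ('i%C * (a - b))) &
      is_derive x (axis R true) (fun y => complex.Im (F (pt y))) (complex.Im ('i%C * (a - b)))].
Proof.
move=> Fd.
pose d (i : bool) : cplx R := if i then 'i%C else 1.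
pose D (i : bool) : cplx R := a * d i + b * conjc (d i).
have ptE (i : bool) (h : R) : pt (x + h *: axis R i) = pt x + h%:C * d i.
  have scE (s : R) : h *: s = h * s by [].
  by case: i; rewrite /pt /d /=; congr (_ +i* _); rewrite ?scE /=; ring.
have key (i : bool) (re : cplx R -> R) : (forall z w, re (z - w) = re z - re w) ->
    (forall z, `|re z| <= cabs z) -> (forall (h : R) z, re (z * h%:C) = re z * h) ->
    is_derive x (axis R i) (fun y => re (F (pt y))) (re (D i)).
  move=> reB re_le reZ; apply: is_derive_quotient => e e0.
  have [dl dl0 hF] := Fd _ e0; exists dl => // h hd.
  have cd : cabs (h%:C * d i) = `|h|.
    by rewrite cabsM cabs_real /d; case: i; rewrite ?cabs1 ?mulr1 //
      /cabs /= expr0n expr1n add0r sqrtr1 mulr1.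
  rewrite ptE -reZ -!reB; apply: le_trans (re_le _) _.
  have := hF (h%:C * d i); rewrite cd => /(_ hd).
  rewrite conjM conj_real /D.
  by have -> : (a * d i + b * conjc (d i)) * h%:C =
    a * (h%:C * d i) + b * (h%:C * conjc (d i)) by ring.
have ReZ (h : R) (z : cplx R) : complex.Re (z * h%:C) = complex.Re z * h.
  by case: z => u v /=; rewrite mulr0 subr0.
have ImZ (h : R) (z : cplx R) : complex.Im (z * h%:C) = complex.Im z * h.
  by case: z => u v /=; rewrite mulr0 add0r.
have D0 : D false = a + b by rewrite /D /d conj1 !mulr1.
have ci : conjc ('i%C : cplx R) = - 'i%C :> cplx R by congr (_ +i* _); rewrite oppr0.
have D1 : D true = 'i%C * (a - b).
  by rewrite /D /d ci; ring.
rewrite -D0 -D1; split; apply: key => //.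
- exact: ReB.
- exact: Re_le_cabs.
- exact: ImB.
- exact: Im_le_cabs.
- exact: ReB.
- exact: Re_le_cabs.
- exact: ImB.
- exact: Im_le_cabs.
Qed.

End CircleNull.

(** * Quasiconformality *)

Section PerturbedInversionQuasiconformal.
Variables (R : realType) (k : R) (c : cplx R) (E : set (R * R)).
Variables (F : sphere R -> sphere R) (psi : cplx R -> cplx R).
Hypothesis k01 : 0 <= k < 1.
Hypothesis psi_lipschitz : forall x y : cplx R, cabs (psi x - psi y) <= k * cabs (x - y).
Hypothesis F_fin : forall z : cplx R, z != c ->
  F (fin z) = fin (1 / (z - c) + psi (1 / (z - c))).
Hypothesis F_pole : F (fin c) = infty.
Hypothesis F_infty : F infty = fin (psi 0).
Local Notation mu1 := (@lebesgue_measure R).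
Local Notation mu2 := (mu1 \x mu1)%E.
Hypothesis E_measurable : measurable E.
Hypothesis E_null : mu2 E = 0%E.
Hypothesis psi_diff : forall x, pt x != c -> ~ E x ->
  exists a b, real_diff psi (1 / (pt x - c)) a b.

Let k0 : 0 <= k. Proof. by case/andP: k01. Qed.
Let k1 : 0 < 1 - k. Proof. by case/andP: k01; rewrite subr_gt0. Qed.

Let Z (z : cplx R) : cplx R := affine (F (fin z)).
Let U := [set x : R * R | [set: sphere R] (fin (pt x)) /\ F (fin (pt x)) <> infty].

Let UE x : U x <-> pt x != c.
Proof.
split=> [[_ Fx]|xc]; last by split=> //; rewrite F_fin.
by apply/eqP => xc; apply: Fx; rewrite xc F_pole.
Qed.

Let ZE z : z != c -> Z z = 1 / (z - c) + psi (1 / (z - c)).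
Proof. by move=> zc; rewrite /Z F_fin. Qed.

(** By the chain rule Z_z = (1 + a) al and Z_zbar = b conj al with al = - 1/(z - c)^2. The
    dilatation bound follows from |b| <= k - |a| <= k (1 - |a|) <= k |1 + a|. *)
Let Z_diff x : pt x != c -> ~ E x -> exists a b : cplx R,
  [/\ real_diff Z (pt x) a b, cabs b <= k * cabs a &
      cabs a + cabs b <= (1 + k) / cabs (pt x - c) ^+ 2].
Proof.
move=> xc nE; have [a [b ab]] := psi_diff xc nE.
have abk : cabs a + cabs b <= k.
  apply: (real_diff_lipschitz ltr01 _ ab) => u _.
  by rewrite (le_trans (psi_lipschitz _ _)) // addrC addKr.
have z0 : pt x - c != 0 by rewrite subr_eq0.
have cz : 0 < cabs (pt x - c) by rewrite cabs_gt0.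
pose al := - (pt x - c) ^- 2.
have inv : real_diff (fun z => (z - c)^-1) (pt x) al 0.
  have sub : real_diff (fun z => z - c) (pt x) 1 0.
    by have := real_diffD (real_diff_id (pt x)) (real_diff_cst (- c) _); rewrite !addr0.
  by have := real_diff_comp sub (real_diff_inv z0); rewrite mulr1 !mul0r mulr0 !addr0.
have Td := real_diffD (real_diff_id (1 / (pt x - c))) ab; rewrite add0r div1r in Td.
have Zd : real_diff (fun z => (z - c)^-1 + psi (z - c)^-1) (pt x) ((1 + a) * al) (b * conjc al).
  have := real_diff_comp inv Td.
  by rewrite (_ : conjc 0 = 0 :> cplx R) ?mulr0 ?addr0 ?add0r //; exact: (rmorph0 (@conjc R)).
have cal : cabs al = (cabs (pt x - c) ^+ 2)^-1 by rewrite /al cabsN cabsV cabsX.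
exists ((1 + a) * al), (b * conjc al); split.
- apply: real_diff_near cz _ Zd => u uz.
  have zuc : pt x + u != c.
    by apply: contraTneq uz => <-; rewrite opprD addrA subrr sub0r cabsN ltxx.
  by rewrite ZE // !div1r.
- rewrite !cabsM cabs_conj mulrA; apply: ler_wpM2r; first exact: cabs_ge0.
  have := cabs_sub 1 (- a); rewrite cabs1 cabsN opprK => h1.
  have h2 := cabs_ge0 a; have h3 : k * (1 - cabs a) <= k * cabs (1 + a) by apply: ler_wpM2l.
  apply: le_trans h3; have : cabs b <= k - cabs a by lra.
  move/le_trans; apply; rewrite mulrBr mulr1 lerD2l lerN2 ler_piMl //.
  by case/andP: k01 => _ /ltW.
rewrite !cabsM cabs_conj cal -mulrDl; apply: ler_wpM2r; first by rewrite invr_ge0 sqr_ge0.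
have := cabsD 1 a; rewrite cabs1; lra.
Qed.

Let Z_lipschitz (x y : cplx R) : x != c -> y != c ->
  cabs (Z y - Z x) <= (1 + k) * (cabs (y - x) / (cabs (x - c) * cabs (y - c))).
Proof.
move=> xc yc; rewrite !ZE //.
apply: le_trans (perturbed_identity_le psi_lipschitz _ _) _.
apply: ler_wpM2l; first by rewrite addr_ge0.
have x0 : x - c != 0 by rewrite subr_eq0.
have y0 : y - c != 0 by rewrite subr_eq0.
have -> : 1 / (y - c) - 1 / (x - c) = - (y - x) / ((x - c) * (y - c)).
  by field; rewrite x0 y0.
by rewrite cabsM cabsN cabsV cabsM.
Qed.

(** A compact set in U stays at distance 2 d from c, and shifts shorter than d stay at distance d,
    where the inversion is Lipschitz. *)
Let Z_local (K : set (R * R)) : compact K -> K `<=` U ->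
  exists d M : R, [/\ 0 < d, 0 <= M, forall x, K x -> 2 * d <= cabs (pt x - c) &
   forall x (u : cplx R), K x -> cabs u < d -> cabs (Z (pt x + u) - Z (pt x)) <= M * cabs u].
Proof.
move=> cK KU.
have Kc x : K x -> pt x != c by move=> /KU /UE.
have [M M0 hM] : exists2 M : R, 0 <= M & forall x, K x -> `|(cabs (pt x - c))^-1| <= M.
  apply: compact_bounded_fun => //; apply: continuous_in_subspaceT => x /[!inE] Kx.
  apply: cvgV; first by rewrite cabs_eq0 subr_eq0 Kc.
  apply: (@continuous_comp _ _ _ (fun y => pt y - c) (@cabs R)); last exact: cabs_continuous.
  apply: (@continuous_comp _ _ _ (@pt R) (fun y => y - c)); first exact: pt_continuous.
  apply: (@lipschitz_continuous_cplx _ _ 1) => // y z.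
  by rewrite mul1r opprB addrA subrK.
(* M bounds 1/|z - c| on K, hence |z - c| >= 1/(M + 1) = 2 d there. *)
pose d := (M + 1)^-1 / 2; have M1 : 0 < M + 1 by rewrite ltr_wpDl.
have d0 : 0 < d by rewrite divr_gt0 ?invr_gt0.
have far x : K x -> 2 * d <= cabs (pt x - c).
  move=> Kx; have cz : 0 < cabs (pt x - c) by rewrite cabs_gt0 subr_eq0 Kc.
  have -> : 2 * d = (M + 1)^-1 by rewrite /d mulrCA mulfV ?mulr1.
  rewrite -[leRHS]invrK lef_pV2 ?posrE ?invr_gt0 //.
  have := hM x Kx; rewrite ger0_norm ?invr_ge0 ?cabs_ge0 // => /le_trans; apply.
  by rewrite lerDl.
clearbody d; exists d, ((1 + k) / (2 * d * d)); split=> //.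
  by apply: divr_ge0; [exact: addr_ge0 | rewrite !mulr_ge0 ?(ltW d0)].
move=> x u Kx ud; have fx := far x Kx.
have fy : d <= cabs (pt x + u - c).
  have := cabs_sub (pt x - c) (- u); rewrite cabsN opprK addrAC; apply: le_trans.
  by lra.
have yc : pt x + u != c by rewrite -subr_eq0 -cabs_gt0 (lt_le_trans d0).
apply: le_trans (Z_lipschitz (Kc _ Kx) yc) _.
rewrite [pt x + u - pt x]addrC addKr -mulrA; apply: ler_wpM2l; first by rewrite addr_ge0.
rewrite mulrC; apply: ler_wpM2r; first exact: cabs_ge0.
rewrite lef_pV2 ?posrE.
- by apply: ler_pM => //; rewrite ?mulr_ge0 ?(ltW d0).
- by rewrite mulr_gt0 // cabs_gt0 subr_eq0 ?Kc.
- by rewrite !mulr_gt0.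
Qed.

Let U_open : open U.
Proof.
rewrite openE => x /UE xc; apply/nbhs_ballP.
have cz : 0 < cabs (pt x - c) by rewrite cabs_gt0 subr_eq0.
have nb : nbhs (pt x) [set z | z != c].
  apply/nbhs_cplx; exists (cabs (pt x - c)) => // y hy.
  by apply: contraTneq hy => ->; rewrite cabsB ltxx.
have /nbhs_ballP [e e0 he] := pt_continuous nb.
by exists e => // y /he yc; apply/UE.
Qed.

Let ptD (b : bool) (x : R * R) (h : R) :
  exists2 u : cplx R, pt (x + h *: axis R b) = pt x + u & cabs u = `|h|.
Proof.
have scE (s : R) : h *: s = h * s by [].
exists (h%:C * (if b then 'i%C else 1)).
  by case: b; rewrite /pt /=; congr (_ +i* _); rewrite ?scE /=; ring.
by rewrite cabsM cabs_real; case: b; rewrite ?cabs1 ?mulr1 //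
  /cabs /= expr0n expr1n add0r sqrtr1 mulr1.
Qed.

(* Both for re = Re and for re = Im. *)
Let coordinate_weak_partial (b : bool) (re : cplx R -> R) (w : R * R -> R) :
  (forall z v, re (z - v) = re z - re v) -> (forall z, `|re z| <= cabs z) ->
  (forall x, U x -> ~ E x -> is_derive x (axis R b) (fun y => re (Z (pt y))) (w x)) ->
  (forall x, U x -> `|w x| <= (1 + k) / cabs (pt x - c) ^+ 2) ->
  (forall x, E x -> w x = 0) ->
  weak_partial b U (fun x => re (Z (pt x))) w /\ locally_L2 U w.
Proof.
move=> reB re_le wd w_le wE; pose u x := re (Z (pt x)).
have uc : {in U, continuous u}.
  move=> x /[!inE] Ux; apply/cvgrPdist_lt => e e0.
  have K1 : compact [set x] by exact: compact_set1.
  have [|d [M [d0 M0 _ hM]]] := Z_local K1; first by move=> y ->.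
  have M1 : 0 < M + 1 by rewrite ltr_wpDl.
  have nb : nbhs (pt x) [set z | cabs (z - pt x) < Num.min d (e / (M + 1))].
    apply/nbhs_cplx; exists (Num.min d (e / (M + 1))) => //.
    by rewrite lt_min d0 divr_gt0.
  have nb2 : nbhs x [set y | cabs (pt y - pt x) < Num.min d (e / (M + 1))] := pt_continuous nb.
  move: nb2; apply: filterS => y; rewrite /mkset lt_min ltr_pdivlMr // => /andP[yd ye].
  rewrite distrC /u -reB; apply: le_lt_trans (re_le _) _.
  have := hM x _ erefl yd; rewrite [pt x + _]addrC subrK => /le_lt_trans; apply.
  apply: le_lt_trans ye; rewrite mulrC; apply: ler_wpM2l; first exact: cabs_ge0.
  by rewrite lerDl.
have mU : measurable U by exact: open_measurable_plane.
have mu : measurable_fun setT (u \_ U).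
  have mUu : measurable_fun U u by exact: open_continuous_measurable_plane U_open uc.
  exact: (measurable_restrictT u mU).1 mUu.
pose h (n : nat) : R := n.+1%:R^-1.
have hp n : 0 < h n by rewrite invr_gt0.
(* w is measurable as a pointwise limit of difference quotients. The indicator gives the limit 0 on
   E, and u is extended by 0 because a translate may leave U. *)
pose q n x := \1_(~` E) x * ((h n)^-1 * ((u \_ U) (translate (h n *: axis R b) x) - (u \_ U) x)).
have mw : measurable_fun U w.
  apply: (@measurable_fun_cvg _ _ _ _ q).
    move=> n; apply: measurable_funTS; apply: measurable_funM.
      by apply: measurable_indic; exact: measurableC.
    apply: measurable_funM => //; apply: measurable_funB => //.
    by apply: measurableT_comp => //; exact: translate_measurable.
  move=> x Ux; have [Ex|nE] := pselect (E x).
    rewrite (wE _ Ex); apply: cvg_near_cst; near=> n.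
    by rewrite /q indicE memNset ?mul0r //=; apply.
  have dx := wd _ Ux nE.
  have dd : derivable u x (axis R b) by exact: ex_derive.
  have -> : w x = 'D_(axis R b) u x by rewrite derive_val.
  move: dd; rewrite /derivable => /cvg_ex [l lv].
  have -> : 'D_(axis R b) u x = l by apply/cvg_lim.
  have hh : h @ \oo --> (0 : R)^'.
    move=> P; rewrite /nbhs /= /dnbhs /within /= => /(cvg_harmonic) hP.
    by move: hP; rewrite /nbhs /=; apply: filterS => n /=; apply; exact: lt0r_neq0.
  have := cvg_comp _ _ hh lv; apply: cvg_trans; apply: near_eq_cvg.
  have /nbhs_ballP [e /= e0 eU] := open_nbhs_nbhs (conj U_open Ux).
  have /cvgrPdist_lt /(_ _ e0) := @cvg_harmonic R; apply: filterS => n.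
  rewrite sub0r normrN => hn.
  have Uy : U (translate (h n *: axis R b) x) by apply: eU; exact: ball_axis.
  rewrite /q indicE mem_set // mul1r /patch !mem_set //=.
  by rewrite [_ *: axis R b + x]addrC.
split.
  apply: (weak_partial_lipschitz (E := E)) => // K cK KU.
  have [d [M [d0 M0 _ hM]]] := Z_local cK KU.
  exists d, M; split=> // x s Kx sd; have [v -> cv] := ptD b x s.
  by rewrite -reB; apply: le_trans (re_le _) _; rewrite -cv; apply: hM => //; rewrite cv.
split=> // K cK KU.
have [d [M [d0 M0 far _]]] := Z_local cK KU.
pose C := (1 + k) / (2 * d) ^+ 2.
have wC x : K x -> `|w x| <= C.
  move=> Kx; apply: le_trans (w_le _ (KU _ Kx)) _; apply: ler_wpM2l; first by rewrite addr_ge0.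
  have fx := far _ Kx; have d2 : 0 < 2 * d by rewrite mulr_gt0.
  rewrite lef_pV2 ?posrE ?exprn_gt0 ?(lt_le_trans d2 fx) //.
  by rewrite ler_sqr ?nnegrE ?cabs_ge0 // ltW.
have [B B0 KB] := compact_coord_bounded cK.
have mK : measurable K.
  by apply: closed_measurable_plane; exact: compact_closed.
have Kfin : (mu2 K < +oo)%E.
  apply: le_lt_trans (closed_square_finite B); apply: le_measure; rewrite ?inE //.
  exact: closed_square_measurable.
have mwK : measurable_fun K (fun x => (w x ^+ 2)%:E).
  apply/measurable_EFinP; apply: measurable_funX.
  exact: measurable_funS mw.
have : (\int[mu2]_(x in K) (w x ^+ 2)%:E <= \int[mu2]_(x in K) (C ^+ 2)%:E)%E.
  apply: ge0_le_integral => //.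
  - by move=> x _; rewrite lee_fin sqr_ge0.
  - move=> x Kx; rewrite lee_fin -real_normK ?num_real // ler_sqr ?nnegrE ?wC //.
    exact: le_trans (normr_ge0 _) (wC _ Kx).
move=> /le_lt_trans; apply; rewrite integral_cst //.
by apply: lte_mul_pinfty; rewrite ?lee_fin ?sqr_ge0.
Unshelve. all: by end_near. Qed.

Lemma perturbed_inversion_quasiconformal : quasiconformal k [set: sphere R] F.
Proof.
split.
- exact: perturbed_inversion_homeo k01 psi_lipschitz F_fin F_pole F_infty.
- apply: (perturbed_inversion_sense_preserving k01 psi_lipschitz F_fin F_pole) => //.
  exact: openT.
(* Derivatives are chosen at every point, as 0 on E and at c. At c the bound reads 0 <= 0, the
   inverse of 0 being 0. *)
have sel (x : R * R) : exists y : cplx R * cplx R,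
    (pt x != c -> ~ E x -> real_diff Z (pt x) y.1 y.2) /\
    [/\ cabs y.2 <= k * cabs y.1,
      cabs y.1 + cabs y.2 <= (1 + k) / cabs (pt x - c) ^+ 2 &
      E x -> y = (0, 0)].
  have zero : cabs (0 : cplx R) <= k * cabs (0 : cplx R) /\
     cabs (0 : cplx R) + cabs (0 : cplx R) <= (1 + k) / cabs (pt x - c) ^+ 2.
    by rewrite cabs0 mulr0 addr0; split=> //; rewrite divr_ge0 ?sqr_ge0 ?addr_ge0.
  have [xc|xc] := boolP (pt x != c); last by exists (0, 0); split=> //; split; case: zero.
  have [Ex|nE] := pselect (E x); first by exists (0, 0); split=> //; split; case: zero.
  have [a [b [h1 h2 h3]]] := Z_diff xc nE.
  by exists (a, b); split.
have [ab abP] := choice sel.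
pose Fx x := (ab x).1 + (ab x).2.
pose Fy x : cplx R := 'i%C * ((ab x).1 - (ab x).2).
have ci : cabs ('i%C : cplx R) = 1 by rewrite /cabs /= expr0n expr1n add0r sqrtr1.
have Fx_le x : cabs (Fx x) <= (1 + k) / cabs (pt x - c) ^+ 2.
  by have [_ [_ h _]] := abP x; apply: le_trans (cabsD _ _) h.
have Fy_le x : cabs (Fy x) <= (1 + k) / cabs (pt x - c) ^+ 2.
  have [_ [_ h _]] := abP x; rewrite /Fy cabsM ci mul1r.
  by apply: le_trans (cabsD _ _) _; rewrite cabsN.
have Fx0 x : E x -> Fx x = 0 by move=> Ex; have [_ [_ _ /(_ Ex) h]] := abP x; rewrite /Fx h addr0.
have Fy0 x : E x -> Fy x = 0.
  by move=> Ex; have [_ [_ _ /(_ Ex) h]] := abP x; rewrite /Fy h subrr mulr0.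
have dF x : U x -> ~ E x -> real_diff Z (pt x) (ab x).1 (ab x).2.
  by move=> /UE xc nE; have [h _] := abP x; exact: h.
have coord (b : bool) (re : cplx R -> R) (G : R * R -> cplx R) :
    (forall z v, re (z - v) = re z - re v) -> (forall z, `|re z| <= cabs z) ->
    re 0 = 0 ->
    (forall x, U x -> ~ E x -> is_derive x (axis R b) (fun y => re (Z (pt y))) (re (G x))) ->
    (forall x, cabs (G x) <= (1 + k) / cabs (pt x - c) ^+ 2) ->
    (forall x, E x -> G x = 0) ->
    weak_partial b U (fun x => re (Z (pt x))) (fun x => re (G x)) /\
    locally_L2 U (fun x => re (G x)).
  move=> reB re_le re0 dG GM GE; apply: coordinate_weak_partial => //.
    by move=> x _; exact: le_trans (re_le _) (GM x).
  by move=> x Ex; rewrite GE.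
have [|A1 A2] := coord false (@complex.Re R) Fx (@ReB R) (@Re_le_cabs R) erefl _ Fx_le Fx0.
  by move=> x Ux nE; have [h _ _ _] := real_diff_is_derive (dF x Ux nE).
have [|A3 A4] := coord false (@complex.Im R) Fx (@ImB R) (@Im_le_cabs R) erefl _ Fx_le Fx0.
  by move=> x Ux nE; have [_ h _ _] := real_diff_is_derive (dF x Ux nE).
have [|B1 B2] := coord true (@complex.Re R) Fy (@ReB R) (@Re_le_cabs R) erefl _ Fy_le Fy0.
  by move=> x Ux nE; have [_ _ h _] := real_diff_is_derive (dF x Ux nE).
have [|B3 B4] := coord true (@complex.Im R) Fy (@ImB R) (@Im_le_cabs R) erefl _ Fy_le Fy0.
  by move=> x Ux nE; have [_ _ _ h] := real_diff_is_derive (dF x Ux nE).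
exists Fx, Fy; split; [by split|by split|].
(* With both derivatives set to 0 on E the dilatation bound holds at every point, so the exceptional
   set is empty. *)
exists set0; split=> // x /= nx; apply: nx => _.
have [_ [dil _ _]] := abP x.
have ii : 'i%C * 'i%C = -1 :> cplx R by rewrite -expr2 sqr_i.
have -> : (Fx x + 'i%C * Fy x) / 2 = (ab x).2.
  have -> : Fx x + 'i%C * Fy x = (ab x).1 + (ab x).2 + 'i%C * 'i%C * ((ab x).1 - (ab x).2).
    by rewrite /Fx /Fy mulrA.
  by rewrite ii; field.
have -> : (Fx x - 'i%C * Fy x) / 2 = (ab x).1.
  have -> : Fx x - 'i%C * Fy x = (ab x).1 + (ab x).2 - 'i%C * 'i%C * ((ab x).1 - (ab x).2).
    by rewrite /Fx /Fy mulrA.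
  by rewrite ii; field.
have : (cabs (ab x).2)%:C <= (k * cabs (ab x).1)%:C :> cplx R by rewrite lecR.
by rewrite realM.
Qed.

End PerturbedInversionQuasiconformal.

Theorem theorem1p2 (R : realType) (k p : R)
    (A : cplx R) (a b : nat -> cplx R) (h g : cplx R -> cplx R)
    (f : cplx R -> sphere R)
    (hk : 0 <= k < 1) (hp : 0 <= p < 1)
    (f_harmonic : charmonic (@disk R `\ (p%:C : cplx R)) (@affine R \o f))
    (f_form : has_form p A a b h g f)
    (f_bound : forall z : cplx R, disk z ->
       `|derive1 h z| + `|derive1 g z| <=
       (k / (1 + p) ^+ 2)%:C - ((p ^+ 2 + 1) / (1 - p ^+ 2))%:C * `|A|) :
  SigmaHk k p f /\
  exists hbar gbar : cplx R -> cplx R,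
    [/\ continuous_extension h hbar, continuous_extension g gbar,
        quasiconformal k [set: sphere R] (F_ext p f hbar gbar)
      & extends (@disk R) f (F_ext p f hbar gbar)].
Proof.
have k01 := hk; have k0 : 0 <= k by case/andP: hk.
have [hbar [gbar [psi [hc gc psi_lip psi_diff [Ffin Fpole Finf]]]]] :=
  F_ext_perturbed_identity hp f_form f_bound.
have qc : quasiconformal k [set: sphere R] (F_ext p f hbar gbar).
  (* The exceptional set is the circle |z| = 1, where the two formulas for F meet, and the centre of
     inversion is p. *)
  apply: (@perturbed_inversion_quasiconformal _ _ p%:C (@unit_circle R) _ psi) => //.
  - exact: unit_circle_measurable.
  - exact: unit_circle_null.
  - by move=> x xp xc; apply: psi_diff => //; apply/eqP.
have ext : extends (@disk R) f (F_ext p f hbar gbar).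
  by move=> z zd; rewrite /F_ext /fin zd.
have fF (z : cplx R) : disk z -> f z = F_ext p f hbar gbar (fin z) by move=> /ext.
have open_disk : open (@disk R).
  rewrite openE => z; rewrite diskE => z1; apply/nbhs_cplx.
  exists (1 - cabs z); first by rewrite subr_gt0.
  move=> y yz; rewrite diskE -[y](subrK z); apply: le_lt_trans (cabsD _ _) _.
  by rewrite -ltrBrDr.
split; last by exists hbar, gbar.
split; last by exists (F_ext p f hbar gbar).
split=> //.
- exact: (perturbed_inversion_sense_preserving k01 psi_lip Ffin Fpole).
- move=> x y; rewrite !inE => xd yd; rewrite !fF //.
  by move=> /(perturbed_inversion_injective k01 psi_lip Ffin Fpole Finf) [].
by exists A, a, b, h, g.
Qed.
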